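(* Let $n\ge1$, $q\ge2$, $\tau\ge 1$ be integers, let $M$ be an integer with $R(n,\tau)<M\le R(n,\tau+1)$, and let $h:[-1,1)\to(0,+\infty)$ be strictly absolutely monotone. Let $$B:=\begin{cases} M\sum_{i=0}^{k-1}\rho_ih(\alpha_i),&\tau=2k-1,\\ M\sum_{i=0}^{k}\gamma_ih(\beta_i),&\tau=2k,\end{cases}$$ which is a lower bound both for $\mathcal{L}(n,M,\tau;h)$ and for $\mathcal{E}(n,M;h)$. Let $\mathcal{A}$ denote either $A_{n,M,\tau;h}$ (for the bound on $\mathcal{L}(n,M,\tau;h)$) or $A_{n,M;h}$ (for the bound on $\mathcal{E}(n,M;h)$). Then, for each of these two choices of $\mathcal{A}$, the following holds. There exists a polynomial $f\in\mathcal{A}$ of degree at least $\tau+1$, satisfying $f(t)\le h(t)$ for all $t\in[-1,1)$, that improves the bound, i.e. $f_0M-f(1)>B$, if and only if $P_j(n,s)<0$ for some $j\ge\tau+1$. Furthermore, if $P_j(n,s)<0$ for some $j\ge\tau+1$, then the bound can be improved (in the same sense) by a polynomial $f\in\mathcal{A}$ of degree exactly $j$ satisfying $f(t)\le h(t)$ for all $t\in[-1,1)$. (Here $j\le n$ throughout.)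
   Context: $\mathbb{H}(n,q)$ is the set of all vectors of length $n$ over $\{0,1,\dots,q-1\}$, $d(x,y)$ is the Hamming distance, $\langle x,y\rangle:=1-\frac{2d(x,y)}{n}$, and $T_n=\{-1+\frac{2i}{n}:0\le i\le n\}$. For a code $C\subset\mathbb{H}(n,q)$ (nonempty subset), $E(n,C;h):=\frac{1}{|C|}\sum_{x,y\in C,\,x\ne y}h(\langle x,y\rangle)$, and $\mathcal{E}(n,M;h):=\min\{E(n,C;h):|C|=M\}$. A $\tau$-design is a code $C$ with $|C|=M=\lambda q^\tau$ for a positive integer $\lambda$ such that, in the $M\times n$ matrix whose rows are the codewords, every $M\times\tau$ submatrix contains every element of $\mathbb{H}(\tau,q)$ exactly $\lambda$ times as a row; $\mathcal{L}(n,M,\tau;h)$ is the minimum of $E(n,C;h)$ over $\tau$-designs $C\subset\mathbb{H}(n,q)$ with $|C|=M$ ($\infty$ if there are none). $h$ is strictly absolutely monotone if $h$ and all its derivatives are defined and positive on $[-1,1)$. Krawtchouk polynomials: for $0\le i\le n$, $Q_i^{(n,q)}(t):=K_i^{(n,q)}(z)/\left((q-1)^i\binom{n}{i}\right)$ with $z=n(1-t)/2$ and $K_i^{(n,q)}(z)=\sum_{j=0}^i(-1)^j(q-1)^{i-j}\binom{z}{j}\binom{n-z}{i-j}$. Every real polynomial of degree at most $n$ has a unique expansion $f=\sum_{i=0}^nf_iQ_i^{(n,q)}$. For an arbitrary real polynomial, $f_0:=q^{-n}\sum_{z=0}^{n}\binom{n}{z}(q-1)^zf\left(1-\frac{2z}{n}\right)$,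 which agrees with the expansion coefficient when $\deg f\le n$. $A_{n,M;h}$ is the set of real polynomials $f=\sum_{i=0}^nf_iQ_i^{(n,q)}$ with $f(t)\le h(t)$ for every $t\in T_n\setminus\{1\}$ and $f_i\ge0$ for every $i\ge1$. $A_{n,M,\tau;h}$ is the set of real polynomials $f=\sum_{i=0}^nf_iQ_i^{(n,q)}$ with $f(t)\le h(t)$ for every $t\in T_n\setminus\{1\}$ and $f_i\ge0$ for every $i\ge\tau+1$. Rao bound: $R(n,2k-1):=q\sum_{i=0}^{k-1}\binom{n-1}{i}(q-1)^i$ and $R(n,2k):=\sum_{i=0}^{k}\binom{n}{i}(q-1)^i$. Nodes and weights (Levenshtein). For $M\in(R(n,2k-1),R(n,2k)]$, the reals $-1<\alpha_0<\dots<\alpha_{k-1}<1$ and positive $\rho_0,\dots,\rho_{k-1}$ are the uniquely determined numbers with $f_0=\frac{f(1)}{M}+\sum_{i=0}^{k-1}\rho_if(\alpha_i)$ for every real polynomial $f$ of degree at most $2k-1$. For $M\in(R(n,2k),R(n,2k+1)]$, the reals $-1=\beta_0<\beta_1<\dots<\beta_k<1$ and positive $\gamma_0,\dots,\gamma_k$ are the uniquely determined numbers with $f_0=\frac{f(1)}{M}+\sum_{i=0}^{k}\gamma_if(\beta_i)$ for every real polynomial $f$ of degree at most $2k$. Test functions: let $s$ be the largest node ($s=\alpha_{k-1}$ if $\tau=2k-1$, $s=\beta_k$ if $\tau=2k$). For $\tau+1\le j\le n$, $P_j(n,s):=\frac1M+\sum_{i=0}^{k-1}\rho_iQ_j^{(n,q)}(\alpha_i)$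 if $\tau=2k-1$, and $P_j(n,s):=\frac1M+\sum_{i=0}^{k}\gamma_iQ_j^{(n,q)}(\beta_i)$ if $\tau=2k$. *)

(* Defs.v *)
From HB Require Import structures.
From mathcomp Require Import all_boot all_order all_algebra.
From mathcomp Require Import all_classical all_reals all_analysis.

Set Implicit Arguments.
Unset Strict Implicit.
Unset Printing Implicit Defensive.

Import Order.TTheory GRing.Theory Num.Theory.
Import numFieldNormedType.Exports.

Local Open Scope classical_set_scope.
Local Open Scope ring_scope.

Definition hamming (n q : nat) : finType := {ffun 'I_n -> 'I_q}.

Definition hdist (n q : nat) (x y : hamming n q) : nat :=
  #|[set i : 'I_n | x i != y i]%SET|.

Definition hinner (R : realType) (n q : nat) (x y : hamming n q) : R :=
  1 - 2 * (hdist x y)%:R / n%:R.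

Definition T_ (R : realType) (n : nat) : set R :=
  [set t | exists2 i : nat, (i <= n)%N & t = -1 + 2 * i%:R / n%:R].
Arguments T_ : clear implicits.

Definition energy (R : realType) (n q : nat) (h : R -> R)
    (C : {set hamming n q}) : R :=
  (#|C|%:R)^-1 * \sum_(x in C) \sum_(y in C | x != y) h (hinner R x y).

(* An M x tau submatrix is the choice of tau columns, i.e. a strictly
   increasing map c from 'I_tau to 'I_n. *)
Definition is_design (n q tau : nat) (C : {set hamming n q}) : Prop :=
  exists lam : nat, [/\ (0 < lam)%N, #|C| = (lam * q ^ tau)%N &
    forall c : 'I_tau -> 'I_n,
      (forall i j : 'I_tau, (i < j)%N -> (c i < c j)%N) ->
      forall v : hamming tau q,
        #|[set x in C | [ffun i => x (c i)] == v]%SET| = lam].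

(* There are finitely many codes, so these infima are minima when some code
   qualifies; the infimum of the empty set is +oo. *)
Definition min_energy (R : realType) (n q M : nat) (h : R -> R) : \bar R :=
  ereal_inf [set e | exists2 C : {set hamming n q},
    #|C| = M & e = (energy h C)%:E].

Definition min_design_energy (R : realType) (n q M tau : nat) (h : R -> R) :
    \bar R :=
  ereal_inf [set e | exists2 C : {set hamming n q},
    is_design tau C /\ #|C| = M & e = (energy h C)%:E].

(* Derivative relative to D: one-sided at an end point belonging to D. *)
Definition has_derivative_on (R : realType) (D : set R) (g g' : R -> R) :
    Prop :=
  forall x, D x -> (g t - g x) / (t - x) @[t --> within D x^'] --> g' x.

(* A potential on [-1, 1) is a total function of which only the values on
   [-1, 1) are used; hd m is its m-th derivative there. *)
Definition strictly_absolutely_monotone (R : realType) (h : R -> R) : Prop :=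
  exists hd : nat -> R -> R,
    [/\ forall t, -1 <= t < 1 -> hd 0%N t = h t,
        forall m, has_derivative_on [set t | -1 <= t < 1] (hd m) (hd m.+1) &
        forall m t, -1 <= t < 1 -> 0 < hd m t].

Definition binom_poly (R : realType) (p : {poly R}) (j : nat) : {poly R} :=
  (j`!%:R)^-1 *: \prod_(m < j) (p - (m%:R)%:P).

Definition krawtchouk (R : realType) (n q i : nat) : {poly R} :=
  \sum_(j < i.+1) ((-1) ^+ j * (q.-1)%:R ^+ (i - j)) *:
    (binom_poly 'X j * binom_poly ((n%:R)%:P - 'X) (i - j)).

Definition Qpoly (R : realType) (n q i : nat) : {poly R} :=
  ((q.-1)%:R ^+ i * 'C(n, i)%:R)^-1 *:
    (krawtchouk R n q i \Po ((n%:R / 2) *: (1 - 'X))).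

(* Mean of f under the distance distribution of the space: this is the
   coefficient of Qpoly 0 in f when deg f <= n, but it is also needed for
   larger degrees. *)
Definition mean_coef (R : realType) (n q : nat) (f : {poly R}) : R :=
  (q%:R ^+ n)^-1 *
  \sum_(z < n.+1) 'C(n, z)%:R * (q.-1)%:R ^+ z * f.[1 - 2 * z%:R / n%:R].

Definition A_code (R : realType) (n q : nat) (h : R -> R) : set {poly R} :=
  [set f | exists c : nat -> R,
    [/\ f = \sum_(i < n.+1) c i *: Qpoly R n q i,
        forall t, T_ R n t -> t != 1 -> f.[t] <= h t &
        forall i, (1 <= i <= n)%N -> 0 <= c i]].

Definition A_design (R : realType) (n q tau : nat) (h : R -> R) :
    set {poly R} :=
  [set f | exists c : nat -> R,
    [/\ f = \sum_(i < n.+1) c i *: Qpoly R n q i,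
        forall t, T_ R n t -> t != 1 -> f.[t] <= h t &
        forall i, (tau.+1 <= i <= n)%N -> 0 <= c i]].

(* tau = 2k - 1 when odd, with k = uphalf tau; tau = 2k when even, with
   k = tau./2. *)
Definition rao (n q tau : nat) : nat :=
  if odd tau
  then (q * \sum_(i < uphalf tau) 'C(n.-1, i) * q.-1 ^ i)%N
  else (\sum_(i < (tau./2).+1) 'C(n, i) * q.-1 ^ i)%N.

(* The number of nodes is k for tau = 2k - 1 and k + 1 for tau = 2k, which is
   (tau./2).+1 in both cases: x, w stand for (alpha, rho) when tau is odd and
   for (beta, gamma) when tau is even. *)
Record levenshtein_quadrature (R : realType) (n q M tau : nat)
    (x w : 'I_(tau./2).+1 -> R) : Prop := LevenshteinQuadrature {
  lq_increasing : forall i j : 'I_(tau./2).+1, (i < j)%N -> x i < x j;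
  lq_first_odd : odd tau -> -1 < x ord0;
  lq_first_even : ~~ odd tau -> x ord0 = -1;
  lq_last : x ord_max < 1;
  lq_weight_gt0 : forall i, 0 < w i;
  lq_exact : forall f : {poly R}, (size f <= tau.+1)%N ->
    mean_coef n q f = f.[1] / M%:R + \sum_i w i * f.[x i]
}.

Definition universal_bound (R : realType) (M tau : nat)
    (x w : 'I_(tau./2).+1 -> R) (h : R -> R) : R :=
  M%:R * \sum_i w i * h (x i).

Definition test_function (R : realType) (n q M tau : nat)
    (x w : 'I_(tau./2).+1 -> R) (j : nat) : R :=
  (M%:R)^-1 + \sum_i w i * (Qpoly R n q j).[x i].

(* Main.v *)
(* The bound is attained by the Hermite interpolant g <= h of h at the nodes (double
   nodes, except that -1 is simple when tau is even): deg g <= tau, so the quadrature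
   rule gives M g_0 - g(1) = B. For a polynomial f with coefficients c_j one finds
   M f_0 - f(1) - M sum_i w_i f(x_i) = - M sum_(j > tau) c_j P_j, which settles one
   direction. Conversely, if P_j < 0, take f = g + e Q_j where g interpolates h - e Q_j,
   which is still absolutely monotone for small e > 0; f then gains - e M P_j.

   The remaining point is that g has nonnegative Krawtchouk coefficients. Its Newton
   coefficients are positive because (h(t) - h(y)) / (t - y) is again absolutely
   monotone, so it is enough that products of initial segments of prod_i (t - x_i) are
   positive definite; as these are closed under products, single segments suffice.
   For odd tau a segment is a nonnegative combination of the kernels
   T_j = K_0 + ... + K_j, which are orthogonal for (1 - t) times the mean: multiplying a
   discrete measure by t minus its smallest node expresses the old orthogonal
   polynomials nonnegatively in the new ones, and the full product is handled by the
   Rao bounds. Even tau reduces to odd tau - 1 in length n - 1, because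
   (1 + t) F(d(x, y)) is proportional to the sum over coordinates s of
   [x_s = y_s] F(d(x, y)). *)

Require Import Defs.
From HB Require Import structures.
From mathcomp Require Import all_boot all_order all_algebra.
From mathcomp Require Import all_classical all_reals all_analysis.
From mathcomp Require Import ring lra zify.

Set Implicit Arguments.
Unset Strict Implicit.
Unset Printing Implicit Defensive.

Import Order.TTheory GRing.Theory Num.Theory.
Import numFieldNormedType.Exports.

Local Open Scope classical_set_scope.
Local Open Scope ring_scope.

(** * Orthogonal polynomials of a discrete measure *)

Lemma graded_span (F : fieldType) (T : nat -> {poly F}) (m : nat) :
  (forall i, (i < m)%N -> size (T i) = i.+1) ->
  forall f : {poly F}, (size f <= m)%N ->
  exists c : nat -> F, f = \sum_(i < m) c i *: T i.
Proof.
elim: m => [|m IH] sT f sf.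
  exists (fun=> 0); rewrite big_ord0; apply/eqP.
  by rewrite -size_poly_eq0 -leqn0.
have Tm0 : lead_coef (T m) != 0 by rewrite lead_coef_eq0 -size_poly_eq0 sT.
pose a := f`_m / lead_coef (T m).
have [|c fE] := IH (fun i im => sT i (ltnW im)) (f - a *: T m).
  apply/leq_sizeP => j; rewrite leq_eqVlt => /predU1P[<-|mj].
    have lT : (T m)`_m = lead_coef (T m) by rewrite lead_coefE sT.
    by rewrite coefB coefZ lT divfK ?subrr.
  by rewrite coefB coefZ !nth_default ?mulr0 ?subr0 ?sT// (leq_trans sf).
exists (fun i => if i == m then a else c i).
rewrite big_ord_recr /= eqxx -[f in LHS](subrK (a *: T m)) fE; congr (_ + _).
by apply: eq_bigr => i _; rewrite ltn_eqF.
Qed.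

Section DiscreteMeasure.
Variables (R : realFieldType) (k : nat) (p : nat -> R).
Implicit Types (w y : nat -> R) (f g P : {poly R}).

Definition dmeas w f : R := \sum_(i < k) w i * f.[p i].

Lemma dmeasD w f g : dmeas w (f + g) = dmeas w f + dmeas w g.
Proof. by rewrite -big_split; apply: eq_bigr => i _; rewrite hornerD mulrDr. Qed.

Lemma dmeasZ w a f : dmeas w (a *: f) = a * dmeas w f.
Proof.
by rewrite mulr_sumr; apply: eq_bigr => i _; rewrite hornerZ mulrCA.
Qed.

Lemma dmeas0 w : dmeas w 0 = 0.
Proof. by apply: big1 => i _; rewrite horner0 mulr0. Qed.

Lemma dmeas_sum w (I : Type) (s : seq I) (Q : pred I) (F : I -> {poly R}) :
  dmeas w (\sum_(i <- s | Q i) F i) = \sum_(i <- s | Q i) dmeas w (F i).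
Proof. exact: (big_morph _ (dmeasD w) (dmeas0 w)). Qed.

(** Nonnegative weights force [f] to vanish wherever the weight is nonzero. Multiplying the measure
    by [t] minus a node can kill weights, so null norms do occur below. *)
Lemma dmeas_null w f g : (forall i, (i < k)%N -> 0 <= w i) ->
  dmeas w (f * f) = 0 -> dmeas w (g * f) = 0.
Proof.
move=> w0 /eqP; rewrite psumr_eq0 => [/allP ff|i _]; last first.
  by rewrite hornerM mulr_ge0 ?w0 ?sqr_ge0// -expr2 sqr_ge0.
apply: big1 => i _; have /eqP := ff i (mem_index_enum _).
rewrite !hornerM mulrA => /eqP; rewrite !mulf_eq0 -orbA orbb.
by case/orP => /eqP ->; rewrite ?mul0r ?mulr0.
Qed.

(** Only the sign of the leading coefficient is fixed and the norm may be zero, so that such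
    polynomials exist in every degree, even beyond the number of points of positive weight. *)
Definition orthopoly w j P := [/\ size P = j.+1, 0 < lead_coef P &
  forall g, (size g <= j)%N -> dmeas w (P * g) = 0].

Lemma orthopoly_exists w (m : nat) : (forall i, (i < k)%N -> 0 <= w i) ->
  exists P : nat -> {poly R}, forall j, (j < m)%N -> orthopoly w j (P j).
Proof.
move=> w0; elim: m => [|m [P oP]]; first by exists (fun=> 0).
(* Gram-Schmidt on the monomials. If [P i] has norm zero, division by zero makes the coefficient 0,
   and by [dmeas_null] there is nothing to cancel. *)
pose c (i : 'I_m) := dmeas w ('X^m * P i) / dmeas w (P i * P i).
pose r := \sum_(i < m) c i *: P i.
have sr : (size r < m.+1)%N.
  rewrite ltnS; apply: (leq_trans (size_sum _ _ _)); apply/bigmax_leqP => i _.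
  have [sP _ _] := oP i (ltn_ord i).
  by rewrite (leq_trans (size_scale_leq _ _))// sP.
have sQ : size ('X^m - r) = m.+1.
  by rewrite size_polyDl ?size_polyXn // size_polyN.
exists (fun i => if i == m then 'X^m - r else P i) => j.
rewrite ltnS leq_eqVlt => /predU1P[->|jm]; last by rewrite ltn_eqF//; exact: oP.
rewrite eqxx; split=> //.
  by rewrite lead_coefDl ?lead_coefXn ?ltr01// size_polyXn size_polyN.
move=> g sg.
have [i ij|d ->] := @graded_span _ P m _ g sg; first by have [] := oP i ij.
rewrite mulr_sumr dmeas_sum big1// => i _.
rewrite -scalerAr dmeasZ mulrDl dmeasD mulNr -scaleN1r dmeasZ mulN1r.
rewrite /r mulr_suml dmeas_sum (bigD1 i)//= big1 => [|l li]; last first.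
  rewrite -scalerAl dmeasZ.
  have [sPi _ oPi] := oP i (ltn_ord i).
  have [sPl _ oPl] := oP l (ltn_ord l).
  have /orP[il|li'] : (i < l)%N || (l < i)%N by rewrite -neq_ltn eq_sym.
    by rewrite oPl ?mulr0// sPi.
  by rewrite [P l * _]mulrC oPi ?mulr0// sPl.
rewrite -scalerAl dmeasZ addr0 /c.
have [N0|N0] := eqVneq (dmeas w (P i * P i)) 0; last by rewrite divfK// subrr mulr0.
by rewrite (dmeas_null 'X^m w0 N0) mul0r mul0r subrr mulr0.
Qed.

Lemma dmeasM w a f :
  dmeas w (('X - a%:P) * f) = dmeas (fun i => w i * (p i - a)) f.
Proof.
by apply: eq_bigr => i _; rewrite hornerM hornerXsubC mulrA.
Qed.

(* With w' = w * (p - y 0), a w-orthogonal polynomial of degree j is a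
   nonnegative combination of the w'-orthogonal ones of degrees j and j - 1. *)
Lemma orthopoly_prefix_ge0 (m : nat) w y :
  (forall r i, (r <= m)%N -> (i < k)%N ->
     0 <= w i * \prod_(l < r) (p i - y l)) ->
  forall j P, orthopoly w j P ->
  0 <= dmeas w (\prod_(l < m) ('X - (y l)%:P) * P).
Proof.
elim: m w y => [|m IH] w y H j P [sP lP oP].
  have w0 i : (i < k)%N -> 0 <= w i.
    by move=> ik; have := H 0 i isT ik; rewrite big_ord0 mulr1.
  rewrite big_ord0 mul1r -[P]mulr1; case: j => [|j] in sP oP *; last first.
    by rewrite oP// size_poly1.
  have /size_poly1P[a a0 Pa] : size P == 1%N by apply/eqP.
  rewrite Pa mulr1 sumr_ge0// => i _; rewrite hornerC mulr_ge0 ?w0//.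
  by rewrite Pa lead_coefC in lP; exact: ltW.
pose w' i := w i * (p i - y 0%N).
have w0 i : (i < k)%N -> 0 <= w i.
  by move=> ik; have := H 0 i isT ik; rewrite big_ord0 mulr1.
have w'0 i : (i < k)%N -> 0 <= w' i.
  by move=> ik; have := H 1 i isT ik; rewrite big_ord1.
have [P' oP'] := orthopoly_exists j.+1 w'0.
have {}IH i : (i < j.+1)%N ->
    0 <= dmeas w' (\prod_(l < m) ('X - (y l.+1)%:P) * P' i).
  move=> ij; apply: (IH w' (fun l => y l.+1) _ i _ (oP' i ij)) => r l rm lk.
  have := H r.+1 l rm lk; rewrite big_ord_recl mulrA.
  by [].
rewrite big_ord_recl /= -mulrA dmeasM -/w'.
have [i ij||c Pc] := @graded_span _ P' j.+1 _ P; [by have [] := oP' i ij|by rewrite sP|].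
rewrite {1}Pc mulr_sumr dmeas_sum sumr_ge0// => i _.
rewrite -scalerAr dmeasZ.
have [N0|N0] := eqVneq (dmeas w' (P' i * P' i)) 0.
  by rewrite (dmeas_null _ w'0 N0) mulr0.
have Ngt0 : 0 < dmeas w' (P' i * P' i).
  rewrite lt_neqAle eq_sym N0 sumr_ge0// => l _.
  by rewrite hornerM mulr_ge0 ?w'0// -expr2 sqr_ge0.
rewrite mulr_ge0 ?IH//.
have [sPi lPi oPi] := oP' i (ltn_ord i).
(* The top coefficient is a ratio of positive leading coefficients, since no other [P' l] reaches
   degree [j]. *)
have [iE|ij] := eqVneq (i : nat) j.
  have -> : c i = lead_coef P / lead_coef (P' i); last by rewrite divr_ge0// ltW.
  apply: (canRL (mulfK (lt0r_neq0 lPi))).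
  rewrite [in RHS]lead_coefE sP /= {1}Pc coef_sum (bigD1 i)//= big1 => [|l li].
    by rewrite addr0 coefZ lead_coefE sPi iE.
  rewrite coefZ nth_default ?mulr0//.
  have [-> _ _] := oP' l (ltn_ord l).
  rewrite ltn_neqAle -ltnS ltn_ord andbT.
  by apply: contra li => /eqP lj; apply/eqP/val_inj; rewrite /= lj iE.
(* Below the top, the pairing of [P] with [P' i] under [w'] is the pairing of [P] with
   [Q = (t - y 0) P' i] under [w]. It is 0 if [Q] has degree below [j]; if [i + 1 = j], then [Q] is
   a positive multiple of [P] plus lower terms, which leaves a multiple of the norm of [P]. *)
have -> : c i = dmeas w' (P * P' i) / dmeas w' (P' i * P' i).
  apply: (canRL (mulfK N0)).
  rewrite {1}Pc mulr_suml dmeas_sum (bigD1 i)//= big1 => [|l li].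
    by rewrite -scalerAl dmeasZ addr0.
  have [sPl _ oPl] := oP' l (ltn_ord l).
  rewrite -scalerAl dmeasZ.
  have /orP[il|li'] : (i < l)%N || (l < i)%N by rewrite -neq_ltn eq_sym.
    by rewrite oPl ?mulr0// sPi.
  by rewrite [P' l * _]mulrC oPi ?mulr0// sPl.
rewrite divr_ge0 ?(ltW Ngt0)//.
rewrite /w' -dmeasM mulrCA.
set Q := ('X - (y 0%N)%:P) * P' i.
have sQ : size Q = i.+2.
  by rewrite size_monicM ?monicXsubC -?size_poly_eq0 ?sPi// size_XsubC.
have [ij'|ij'] := ltnP i.+1 j; first by rewrite oP// sQ.
have {ij ij'}jE : j = i.+1 by have := ltn_ord i; move/eqP: ij; lia.
pose b := lead_coef (P' i) / lead_coef P.
rewrite -[Q](subrK (b *: P)) mulrDr dmeasD oP ?add0r; last first.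
  apply/leq_sizeP => l; rewrite jE leq_eqVlt => /predU1P[<-|jl].
    have lQ : Q`_i.+1 = lead_coef (P' i).
      by rewrite -[lead_coef _]mul1r -(lead_coefXsubC (y 0%N)) -lead_coefM lead_coefE sQ.
    have lP' : P`_i.+1 = lead_coef P by rewrite lead_coefE sP -jE.
    by rewrite coefB coefZ lP' lQ divfK ?subrr// gt_eqF.
  by rewrite coefB coefZ !nth_default ?mulr0 ?subr0 ?sQ ?sP ?jE.
rewrite -scalerAr dmeasZ mulr_ge0//; first by rewrite divr_ge0 ?ltW.
by rewrite sumr_ge0// => l _; rewrite hornerM mulr_ge0 ?w0// -expr2 sqr_ge0.
Qed.
End DiscreteMeasure.

(** * Node polynomials of a quadrature rule *)

Section Quadrature.
Variables (R : realFieldType) (L : {scalar {poly R}}) (K : nat -> {poly R}).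
Variables (N k : nat) (x w : nat -> R) (M : R).
Implicit Types f : {poly R}.

(** Since [orth_K] makes the squared norm of [K i] equal to its value at 1, this is the
    Christoffel-Darboux kernel with one argument set to 1. *)
Definition kernel_poly (j : nat) : {poly R} := \sum_(i < j.+1) K i.
Local Notation T := kernel_poly.

Hypothesis size_K : forall i, (i <= N)%N -> size (K i) = i.+1.
Hypothesis lead_K : forall i, (i <= N)%N -> 0 < lead_coef (K i).
Hypothesis orth_K : forall i j, (i <= N)%N -> (j <= N)%N ->
  L (K i * K j) = if i == j then (K i).[1] else 0.

Lemma size_kernel_poly j : (j <= N)%N -> size (T j) = j.+1.
Proof.
move=> jN; rewrite /T big_ord_recr /= addrC size_polyDl ?size_K// ltnS.
apply: (leq_trans (size_sum _ _ _)); apply/bigmax_leqP => i _.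
by rewrite size_K// (leq_trans (ltnW (ltn_ord i))).
Qed.

Lemma lead_kernel_poly j : (j <= N)%N -> 0 < lead_coef (T j).
Proof.
move=> jN; rewrite lead_coefE size_kernel_poly//= /T big_ord_recr coefD /=.
rewrite nth_default ?add0r.
  by have := lead_K jN; rewrite lead_coefE size_K.
apply: (leq_trans (size_sum _ _ _)); apply/bigmax_leqP => i _.
by rewrite size_K// (leq_trans (ltnW (ltn_ord i))).
Qed.

Lemma kernel_poly_reproducing j f : (j <= N)%N -> (size f <= j.+1)%N ->
  L (T j * f) = f.[1].
Proof.
move=> jN sf; have [i ij|c ->] := @graded_span _ K j.+1 _ f sf.
  by rewrite size_K// (leq_trans _ jN).
rewrite mulr_sumr linear_sum horner_sum; apply: eq_bigr => i _.
rewrite -scalerAr linearZ /= hornerZ mulr_suml linear_sum (bigD1 i)//= big1.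
  by rewrite orth_K ?eqxx ?addr0// (leq_trans _ jN)// -ltnS.
move=> l /negPf li; rewrite orth_K; last 2 first.
- by rewrite (leq_trans _ jN)// -ltnS.
- by rewrite (leq_trans _ jN)// -ltnS.
by rewrite -[X in if X then _ else _]/(l == i) li.
Qed.

Lemma mean_kernel_poly j : (j <= N)%N -> L (T j) = 1.
Proof.
by move=> jN; rewrite -[T j]mulr1 kernel_poly_reproducing ?size_poly1 ?hornerE.
Qed.

Lemma size_1subX f : size ((1 - 'X) * f) = if f == 0 then 0%N else (size f).+1.
Proof.
have -> : 1 - 'X = - ('X - 1%:P) :> {poly R} by rewrite opprB.
rewrite mulNr size_polyN; case: eqVneq => [->|f0]; first by rewrite mulr0 size_poly0.
by rewrite size_monicM ?monicXsubC// size_XsubC.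
Qed.

(** Pairing with [T j] evaluates at 1, where the factor [1 - t] vanishes. *)
Lemma kernel_poly_orth j f : (j <= N)%N -> (size f <= j)%N ->
  L ((1 - 'X) * (T j * f)) = 0.
Proof.
move=> jN sf; rewrite mulrCA kernel_poly_reproducing//.
  by rewrite !hornerE subrr mul0r.
by rewrite size_1subX; case: eqP.
Qed.

Hypothesis k_gt0 : (0 < k)%N.
Hypothesis k_leN : (k <= N)%N.
Hypothesis x_incr : forall i j, (i < j)%N -> (j < k)%N -> x i < x j.
Hypothesis x_lt1 : forall i, (i < k)%N -> x i < 1.
Hypothesis w_gt0 : forall i, (i < k)%N -> 0 < w i.
Hypothesis M_gt0 : 0 < M.
Hypothesis M_bounds : (T k.-1).[1] < M <= (T k).[1].
Hypothesis exactness : forall f : {poly R}, (size f <= 2 * k)%N ->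
  L f = f.[1] / M + \sum_(i < k) w i * f.[x i].

Definition node_poly (x : nat -> R) (m : nat) : {poly R} :=
  \prod_(i < m) ('X - (x i)%:P).
Local Notation g := (node_poly x).

Lemma size_node_poly (y : nat -> R) m : size (node_poly y m) = m.+1.
Proof.
rewrite /node_poly -(big_mkord xpredT (fun i => 'X - (y i)%:P)).
by rewrite size_prod_XsubC size_iota subn0.
Qed.

Let v i := w i * (1 - x i).

Let v_gt0 i : (i < k)%N -> 0 < v i.
Proof. by move=> ik; rewrite mulr_gt0 ?w_gt0// subr_gt0 x_lt1. Qed.

(** The factor [1 - t] removes the term [f(1) / M], so the quadrature rule becomes the discrete
    measure with weights [v]. *)
Let L_dmeas f : (size f < 2 * k)%N -> L ((1 - 'X) * f) = dmeas k x v f.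
Proof.
move=> sf; rewrite exactness; last by rewrite size_1subX; case: eqP.
rewrite !hornerE subrr !mul0r add0r; apply: eq_bigr => i _.
by rewrite hornerM hornerD hornerN hornerC hornerX /v mulrA.
Qed.

Let orth_T j : (j < k)%N -> orthopoly k x v j (T j).
Proof.
move=> jk; have jN := ltnW (leq_trans jk k_leN).
split; [exact: size_kernel_poly|exact: lead_kernel_poly|move=> f sf].
rewrite -L_dmeas ?kernel_poly_orth//.
apply: (leq_ltn_trans (size_polyMleq _ _)); rewrite size_kernel_poly//; lia.
Qed.

(** A polynomial of degree [j < k] cannot vanish at all [k] distinct nodes. *)
Let normT_gt0 j : (j < k)%N -> 0 < dmeas k x v (T j * T j).
Proof.
move=> jk; have jN := ltnW (leq_trans jk k_leN).
have tge0 (i : 'I_k) : 0 <= v i * (T j * T j).[x i].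
  by rewrite hornerM mulr_ge0 ?(ltW (v_gt0 _))// -expr2 sqr_ge0.
rewrite lt_neqAle sumr_ge0 ?andbT//; apply/eqP => /esym/eqP.
rewrite psumr_eq0// => /allP Tx.
have T0 : T j != 0 by rewrite -size_poly_eq0 size_kernel_poly.
have := max_poly_roots (rs := [seq x i | i <- iota 0 k]) T0.
rewrite size_map size_iota size_kernel_poly// ltnS leqNgt jk.
suff -> : all (root (T j)) [seq x i | i <- iota 0 k].
  suff -> : uniq [seq x i | i <- iota 0 k] by move=> /(_ isT isT).
  rewrite map_inj_in_uniq ?iota_uniq// => a b.
  rewrite !mem_iota !add0n /= => ak bk xab.
  have [ab|ba|//] := ltngtP a b.
    by have := x_incr ab bk; rewrite xab ltxx.
  by have := x_incr ba ak; rewrite xab ltxx.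
apply/allP => _ /mapP[i + ->]; rewrite mem_iota add0n /= => ik.
have := Tx (Ordinal ik) (mem_index_enum _).
by rewrite mulf_eq0 (gt_eqF (v_gt0 ik)) hornerM mulf_eq0 orbb.
Qed.

Let coef_T m (c : nat -> R) j : (m <= N)%N -> (j <= m)%N ->
  L ((1 - 'X) * (T j * \sum_(i < m.+1) c i *: T i)) = c j * L ((1 - 'X) * (T j * T j)).
Proof.
move=> mN jm; rewrite [T j * \sum_(_ < _) _]mulr_sumr mulr_sumr linear_sum /=.
have jm' : (j < m.+1)%N by [].
rewrite (bigD1 (Ordinal jm'))//= big1 => [|l /negP lj]; last first.
  have lN : (l <= N)%N by rewrite (leq_trans _ mN)// -ltnS.
  have jN : (j <= N)%N by rewrite (leq_trans _ mN).
  rewrite -!scalerAr linearZ /=.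
  have [jl|lj'|jl] := ltngtP j l.
  - by rewrite [T j * _]mulrC kernel_poly_orth ?mulr0// size_kernel_poly.
  - by rewrite kernel_poly_orth ?mulr0// size_kernel_poly.
  - by case: lj; apply/eqP/val_inj.
by rewrite addr0 -!scalerAr linearZ /=.
Qed.

(** For [m < k] the coefficient of [T j] has the sign of the pairing of the node product with [T j]
    under [v], which [orthopoly_prefix_ge0] controls. For [m = k] the degrees exceed the exactness
    of the rule and [M_bounds] takes over. *)
Lemma node_poly_kernel_poly m : (m <= k)%N ->
  exists c : nat -> R, (forall j, (j <= m)%N -> 0 <= c j) /\
    g m = \sum_(j < m.+1) c j *: T j.
Proof.
move=> mk; have mN := leq_trans mk k_leN.
have [i im||c gE] := @graded_span _ T m.+1 _ (g m).
- by rewrite size_kernel_poly// (leq_trans _ mN).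
- by rewrite size_node_poly.
exists c; split=> // j jm.
move: mk; rewrite leq_eqVlt => /predU1P[mE|mk]; last first.
  have jk := leq_ltn_trans jm mk.
  have := coef_T c mN jm; rewrite -gE !L_dmeas; last 2 first.
  - rewrite (leq_ltn_trans (size_polyMleq _ _))// size_kernel_poly; lia.
  - rewrite (leq_ltn_trans (size_polyMleq _ _))// size_node_poly size_kernel_poly; lia.
  move=> cE; rewrite -(pmulr_lge0 _ (normT_gt0 jk)) -cE mulrC.
  apply: orthopoly_prefix_ge0 (orth_T jk) => r i rm ik.
  (* At a node among the first [r] the product has a zero factor; at a later node all factors are
     positive because the nodes increase. *)
  have [ir|ri] := ltnP i r.
    by rewrite (bigD1 (Ordinal ir))//= subrr mul0r mulr0.
  rewrite mulr_ge0 ?(ltW (v_gt0 ik))// prodr_ge0// => l _.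
  by rewrite subr_ge0 ltW// x_incr// (leq_trans _ ri).
have {}mE : m = k by [].
(* For m = k the node polynomial is orthogonal to degrees < k - 1, hence equal to
   c_k T_k + c_(k-1) T_(k-1); taking means with the quadrature rule gives
   c_(k-1) (M - T_(k-1)(1)) = c_k (T_k(1) - M). *)
move: jm mN gE; rewrite {}mE => jk kN gE.
have lowc i : (i.+1 < k)%N -> c i = 0.
  move=> ik; have ik' := ltnW ik.
  have := coef_T c kN (ltnW ik'); rewrite -gE !L_dmeas; last 2 first.
  - rewrite (leq_ltn_trans (size_polyMleq _ _))// size_kernel_poly; lia.
  - rewrite (leq_ltn_trans (size_polyMleq _ _))// size_node_poly size_kernel_poly; lia.
  rewrite /dmeas big1 => [|l _].
    by move/esym/eqP; rewrite mulf_eq0 (gt_eqF (normT_gt0 ik')) orbF => /eqP.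
  by rewrite hornerM [(g k).[_]]horner_prod (bigD1 l)//= hornerXsubC subrr !(mul0r,mulr0).
have ck_gt0 : 0 < c k.
  have : lead_coef (g k) = 1 by apply/monicP/monic_prod => i _; exact: monicXsubC.
  rewrite lead_coefE size_node_poly /= gE big_ord_recr coefD /= coefZ.
  rewrite nth_default ?add0r.
    have := lead_kernel_poly kN; rewrite lead_coefE size_kernel_poly//= => l0 cl.
    by rewrite -(pmulr_lgt0 _ l0) cl.
  apply: (leq_trans (size_sum _ _ _)); apply/bigmax_leqP => i _.
  by rewrite (leq_trans (size_scale_leq _ _))// size_kernel_poly// ltnW// (leq_trans _ kN).
have [k' kE] : exists k', k = k'.+1 by case: k k_gt0 => // k' _; exists k'.
have [<-|jk'] := eqVneq k j; first exact: ltW.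
have [jk''|jk''] := ltnP j.+1 k; first by rewrite lowc.
have jE : j = k' by lia.
have gE2 : g k = c k' *: T k' + c k *: T k.
  rewrite gE big_ord_recr /=; congr (_ + _).
  rewrite kE big_ord_recr /= big1 ?add0r// => i _.
  by rewrite lowc ?scale0r// kE ltnS.
have : L (g k) = (g k).[1] / M.
  rewrite exactness ?size_node_poly; last by lia.
  rewrite [X in _ + X]big1 ?addr0// => l _.
  by rewrite horner_prod (bigD1 l)//= hornerXsubC subrr !(mul0r,mulr0).
rewrite gE2 linearD /= !linearZ /= !mean_kernel_poly ?mulr1 ?(leq_trans _ kN) ?kE//.
rewrite -kE !hornerE => cE.
have {}cE : c k' * (M - (T k').[1]) = c k * ((T k).[1] - M).
  by move/(congr1 ( *%R^~ M)): cE; rewrite /= divfK ?lt0r_neq0//; lra.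
move: M_bounds; rewrite kE -pred_Sn -kE => /andP[M1 M2].
rewrite jE -(pmulr_lge0 (c k') (_ : 0 < M - (T k').[1])) ?subr_gt0//.
by rewrite cE mulr_ge0 ?subr_ge0// ltW.
Qed.
End Quadrature.

(** * Krawtchouk polynomials *)

Section Krawtchouk.
Variables (R : realType) (q : nat).
Hypothesis q_gt0 : (0 < q)%N.
Implicit Types (n d i j : nat).

Lemma coef_exp1DX (a : R) m i : ((1 + a *: 'X) ^+ m)`_i = a ^+ i * 'C(m, i)%:R.
Proof.
rewrite exprDn coef_sum.
under eq_bigr => j _ do rewrite expr1n mul1r exprZn coefMn coefZ coefXn.
have [im|mi] := ltnP i m.+1.
  rewrite (bigD1 (Ordinal im))//= eqxx mulr1 big1 ?addr0 ?mulr_natr// => j ji.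
  by rewrite -[i]/(val (Ordinal im)) val_eqE eq_sym (negPf ji) mulr0 mul0rn.
rewrite bin_small// mulr0 big1// => j _.
by rewrite gtn_eqF ?mulr0 ?mul0rn// (leq_trans _ mi).
Qed.

Lemma horner_binom_poly (p : {poly R}) y d j :
  p.[y] = d%:R -> (binom_poly p j).[y] = 'C(d, j)%:R.
Proof.
move=> pyd; rewrite hornerZ horner_prod.
have -> : \prod_(m < j) (p - m%:R%:P).[y] = (d ^_ j)%:R.
  elim: j => [|j IH]; first by rewrite big_ord0.
  rewrite big_ord_recr /= IH ffactnSr !hornerE pyd.
  have [jd|dj] := leqP j d; first by rewrite natrM natrB.
  by rewrite ffact_small// mul0n mul0r.
by rewrite -bin_ffact natrM mulrC mulfK// pnatr_eq0 -lt0n fact_gt0.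
Qed.

(** The generating function at an integer distance; it has one factor per coordinate, which
    [krawtchouk_elem_sym] exploits. *)
Lemma krawtchouk_coef n i d : (d <= n)%N ->
  (krawtchouk R n q i).[d%:R] =
  ((1 + (- 1) *: 'X) ^+ d * (1 + q.-1%:R *: 'X) ^+ (n - d))`_i.
Proof.
move=> dn; rewrite coefM horner_sum; apply: eq_bigr => j _.
rewrite !coef_exp1DX hornerZ hornerM.
rewrite (@horner_binom_poly 'X _ d) ?hornerX//.
rewrite (@horner_binom_poly _ _ (n - d)) ?hornerD ?hornerN ?hornerX ?hornerC ?natrB//.
ring.
Qed.

Lemma krawtchouk_at0 n i : (krawtchouk R n q i).[0] = q.-1%:R ^+ i * 'C(n, i)%:R.
Proof. by rewrite -[0]/(0%:R) krawtchouk_coef// expr0 mul1r subn0 coef_exp1DX. Qed.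

Lemma binom_poly_lead (p : {poly R}) a j : p`_1 = a -> (size p <= 2)%N ->
  (size (binom_poly p j) <= j.+1)%N /\ (binom_poly p j)`_j = a ^+ j / j`!%:R.
Proof.
move=> pa sp; have pE m : p - m%:R%:P = a *: 'X + (p`_0 - m%:R)%:P.
  apply/polyP => -[|[|l]]; rewrite !coefE /= ?mulr0 ?mulr1 ?add0r ?addr0 ?subr0//.
  by rewrite nth_default ?mulr0 ?subr0 ?addr0 // (leq_trans sp).
pose r i := \prod_(m < i) (p - m%:R%:P).
suff [s1 s2] : (size (r j) <= j.+1)%N /\ (r j)`_j = a ^+ j.
  split; first exact: leq_trans (size_scale_leq _ _) s1.
  by rewrite coefZ s2 mulrC.
elim: j => [|j [IH1 IH2]]; first by rewrite /r big_ord0 size_poly1 coefE.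
have -> : r j.+1 = a *: (r j * 'X) + (p`_0 - j%:R) *: r j.
  by rewrite [LHS]big_ord_recr /= pE mulrDr -scalerAr [r j * _%:P]mulrC mul_polyC.
split.
  apply: (leq_trans (size_polyD _ _)); rewrite geq_max; apply/andP; split.
    apply: (leq_trans (size_scale_leq _ _)); apply: (leq_trans (size_polyMleq _ _)).
    by rewrite size_polyX addn2.
  by apply: (leq_trans (size_scale_leq _ _)); exact: leqW.
by rewrite coefD !coefZ coefMX /= IH2 (nth_default _ IH1) mulr0 addr0 -exprS.
Qed.

(** Every summand has degree at most [i], and the top coefficients add up by the binomial theorem
    for [(-1 - (q - 1)) ^ i]. *)
Lemma krawtchouk_lead n i : (size (krawtchouk R n q i) <= i.+1)%N /\
  (krawtchouk R n q i)`_i = (- q%:R) ^+ i / i`!%:R.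
Proof.
have X1 : ('X : {poly R})`_1 = 1 by rewrite coefX.
have sX : (size ('X : {poly R}) <= 2)%N by rewrite size_polyX.
have Y1 : (n%:R%:P - 'X : {poly R})`_1 = -1 by rewrite !coefE sub0r.
have sY : (size (n%:R%:P - 'X : {poly R})%R <= 2)%N by rewrite -opprB size_polyN size_XsubC.
have sB j : (j <= i)%N ->
    (size (binom_poly ('X : {poly R}) j *
      binom_poly (n%:R%:P - 'X : {poly R})%R (i - j))%R <= i.+1)%N.
  move=> ji; apply: (leq_trans (size_polyMleq _ _)).
  have [s1 _] := binom_poly_lead j X1 sX.
  have [s2 _] := binom_poly_lead (i - j) Y1 sY.
  by lia.
split.
  apply: (leq_trans (size_sum _ _ _)); apply/bigmax_leqP => j _.
  by rewrite (leq_trans (size_scale_leq _ _))// sB// -ltnS.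
have -> : - q%:R = - 1 + (- 1) * q.-1%:R :> R.
  by rewrite mulN1r -opprD -[q in LHS](prednK q_gt0) -[in LHS]addn1 natrD addrC.
rewrite addrC exprDn mulr_suml coef_sum; apply: eq_bigr => j _.
have ji : (j <= i)%N by rewrite -ltnS.
rewrite coefZ.
have [s1 l1] := binom_poly_lead j X1 sX.
have [s2 l2] := binom_poly_lead (i - j) Y1 sY.
rewrite coefM (bigD1 j)//= big1 ?addr0 => [|l lj].
  rewrite l1 l2 expr1n exprMn -mulr_natr -(bin_fact ji) !natrM.
  have f1 : j`!%:R != 0 :> R by rewrite pnatr_eq0 -lt0n fact_gt0.
  have f2 : (i - j)`!%:R != 0 :> R by rewrite pnatr_eq0 -lt0n fact_gt0.
  have f3 : 'C(i, j)%:R != 0 :> R by rewrite pnatr_eq0 -lt0n bin_gt0.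
  by field; rewrite f1 f2 f3.
have /orP[jl|jl] : (j < l)%N || (l < j)%N by rewrite -neq_ltn eq_sym.
  by rewrite nth_default ?mul0r// (leq_trans s1).
by rewrite [X in _ * X]nth_default ?mulr0// (leq_trans s2)//; lia.
Qed.

(* Krawtchouk polynomials in the variable t = 1 - 2 z / s; s = n + 1 is needed
   once a coordinate has been deleted from a space of length n + 1. *)
Definition kraw_poly n (s : R) i : {poly R} :=
  krawtchouk R n q i \Po ((s / 2) *: (1 - 'X)).

Lemma horner_kraw_poly n s i z : s != 0 ->
  (kraw_poly n s i).[1 - 2 * z%:R / s] = (krawtchouk R n q i).[z%:R].
Proof.
move=> s0; rewrite horner_comp; congr (_.[_]).
rewrite hornerZ hornerD hornerN hornerX hornerC; field.
exact: s0.
Qed.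

Lemma horner_kraw_poly1 n s i : (kraw_poly n s i).[1] = q.-1%:R ^+ i * 'C(n, i)%:R.
Proof.
by rewrite horner_comp hornerZ hornerD hornerN hornerX hornerC subrr mulr0 krawtchouk_at0.
Qed.

Lemma kraw_poly0 n s : kraw_poly n s 0 = 1.
Proof.
rewrite /kraw_poly /krawtchouk big_ord1 /binom_poly !big_ord0 !expr0 fact0 invr1.
by rewrite !scale1r !mulr1 scale1r -polyC1 comp_polyC.
Qed.

(** The substitution [z = s (1 - t) / 2] has negative slope, which cancels the sign of
    [(- q) ^ i]. *)
Lemma kraw_poly_lead n (s : R) i : 0 < s ->
  size (kraw_poly n s i) = i.+1 /\ 0 < lead_coef (kraw_poly n s i).
Proof.
move=> s0; have [sK lK] := krawtchouk_lead n i.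
have lK0 : (krawtchouk R n q i)`_i != 0.
  rewrite lK mulf_neq0 ?expf_neq0 ?oppr_eq0 ?invr_eq0 ?pnatr_eq0 -?lt0n ?fact_gt0//.
have {}sK : size (krawtchouk R n q i) = i.+1.
  apply/eqP; rewrite eqn_leq sK ltnNge; apply/negP => sKi.
  by rewrite nth_default ?eqxx in lK0.
have s20 : s / 2 != 0 by rewrite gt_eqF// divr_gt0.
have sL : size ((s / 2) *: (1 - 'X) : {poly R}) = 2.
  by rewrite size_scale// -opprB size_polyN -polyC1 size_XsubC.
split.
  by rewrite size_comp_poly2 ?sL ?sK.
rewrite lead_coef_comp ?sL// lead_coefE sK /= lK lead_coefZ -opprB lead_coefN.
rewrite -polyC1 lead_coefXsubC mulrAC -exprMn mulrN mulr1 mulrNN.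
by rewrite divr_gt0 ?ltr0n ?fact_gt0// exprn_gt0// mulr_gt0 ?divr_gt0// ltr0n.
Qed.
End Krawtchouk.

(** * Positive definite kernels on the Hamming space *)

Section HammingSpace.
Variables (R : realType) (n q : nat).
Hypothesis q_gt0 : (0 < q)%N.
Local Notation H := (hamming n q).
Implicit Types (x y : H) (i j : nat).

Definition diff_set x y : {set 'I_n} := [set s | x s != y s]%SET.

Lemma sum_card_set (F : nat -> R) :
  \sum_(D : {set 'I_n}) F #|D| = \sum_(z < n.+1) 'C(n, z)%:R * F z.
Proof.
have cD (D : {set 'I_n}) : (#|D| < n.+1)%N.
  by rewrite ltnS -[X in (_ <= X)%N]card_ord max_card.
rewrite (partition_big (fun D : {set 'I_n} => Ordinal (cD D)) xpredT)//=.
apply: eq_bigr => z _.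
rewrite (eq_bigr (fun=> F z)) => [|D /eqP <-//].
rewrite sumr_const -[LHS]mulr_natl; congr (_%:R * _).
have := card_draws 'I_n z; rewrite card_ord => <-.
by apply: eq_card => D; rewrite !inE.
Qed.

Lemma card_diff_set x (D : {set 'I_n}) :
  #|[pred y | diff_set x y == D]| = (q.-1 ^ #|D|)%N.
Proof.
pose F (s : 'I_n) : pred 'I_q := if s \in D then predC1 (x s) else pred1 (x s).
rewrite -(@eq_card _ (family F)) => [|y]; last first.
  rewrite inE; apply/familyP/eqP => [yF|DE s].
    apply/setP => s; rewrite inE; have := yF s; rewrite /F.
    by case: ifP => _; rewrite !inE eq_sym => // ->.
  rewrite /F -DE !inE; case: ifPn => [|/negbNE /eqP ->]; rewrite ?inE//.
  by rewrite eq_sym.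
rewrite card_family foldrE big_map big_enum /=.
rewrite -prod_nat_const [RHS]big_mkcond /=; apply: eq_bigr => s _.
by rewrite /F; case: ifP => _; rewrite ?cardC1 ?card_ord ?card1.
Qed.

Lemma sum_hdist x (F : nat -> R) :
  \sum_(y : H) F (hdist x y) = \sum_(z < n.+1) 'C(n, z)%:R * q.-1%:R ^+ z * F z.
Proof.
rewrite (partition_big (diff_set x) xpredT)//=.
under [RHS]eq_bigr do rewrite -mulrA.
rewrite -(sum_card_set (fun z => q.-1%:R ^+ z * F z)); apply: eq_bigr => D _.
rewrite (eq_bigr (fun=> F #|D|)) => [|y /eqP <-//].
by rewrite sumr_const card_diff_set -natrX mulr_natl.
Qed.

Definition elem_sym (v : 'I_n -> R) i : R :=
  \sum_(S : {set 'I_n} | #|S| == i) \prod_(s in S) v s.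

Lemma coef_prod1DX (v : 'I_n -> R) i : (\prod_s (1 + v s *: 'X))`_i = elem_sym v i.
Proof.
under eq_bigr do rewrite addrC.
rewrite bigA_distr coef_sum /elem_sym [RHS]big_mkcond; apply: eq_bigr => S _.
rewrite -big_mkcond /= scaler_prod prodr_const coefZ coefXn eq_sym.
by case: ifP => _; rewrite ?mulr1 ?mulr0.
Qed.

(** Up to normalization, the reproducing kernel of the mean-zero functions of the letter at [s]:
    [q - 1] on agreement and [-1] otherwise. *)
Definition agree_val x y (s : 'I_n) : R := q%:R * (x s == y s)%:R - 1.

(** In the generating function, coordinates of [E] where [x] and [y] differ give [1 - X], the others
    in [E] give [1 + (q - 1) X], and those outside give 1. A proper subset [E] serves to delete a
    coordinate. *)
Lemma krawtchouk_elem_sym (E : {set 'I_n}) x y i :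
  (krawtchouk R #|E| q i).[(#|[set s in E | x s != y s]%SET|)%:R] =
  elem_sym (fun s => if s \in E then agree_val x y s else 0) i.
Proof.
set D := [set s in E | _]%SET.
have DE : D \subset E by apply/fintype.subsetP => s; rewrite inE => /andP[].
have q1 : q%:R - 1 = q.-1%:R :> R by rewrite -[q in LHS](prednK q_gt0) -natr1 addrK.
rewrite krawtchouk_coef ?subset_leq_card// -coef_prod1DX; congr (polyseq _)`_i.
rewrite (bigID (mem D)) /= (eq_bigr (fun=> 1 + (- 1) *: 'X)); last first.
  by move=> s; rewrite inE => /andP[-> /negPf xy]; rewrite /agree_val xy mulr0 sub0r.
rewrite prodr_const (bigID (mem E)) /=.
rewrite [X in _ = _ * (_ * X)]big1 ?mulr1 => [|s /andP[_ /negPf ->]]; last first.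
  by rewrite scale0r addr0.
rewrite (eq_bigr (fun=> 1 + q.-1%:R *: 'X)); last first.
  move=> s; rewrite inE => /andP[+ sE].
  by rewrite sE /= negbK /agree_val => /eqP ->; rewrite eqxx mulr1 q1.
rewrite prodr_const -(cardsDS DE); congr (_ * _ ^+ _).
by apply: eq_card => s; rewrite -[RHS]/((s \notin D) && (s \in E)) !inE.
Qed.

Lemma krawtchouk_hdist x y i :
  (krawtchouk R n q i).[(hdist x y)%:R] = elem_sym (agree_val x y) i.
Proof.
have := krawtchouk_elem_sym [set: 'I_n] x y i; rewrite cardsT card_ord.
have -> : [set s in [set: 'I_n] | x s != y s]%SET = diff_set x y.
  by apply/setP => s; rewrite !inE.
move=> ->; apply: eq_bigr => S _; apply: eq_bigr => s _.
by rewrite inE.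
Qed.

Lemma sum_agree_val x (s : 'I_n) :
  \sum_(a : 'I_q) (q%:R * (x s == a)%:R - 1) = 0 :> R.
Proof.
rewrite big_split /= sumr_const card_ord -mulr_sumr (bigD1 (x s))//= eqxx big1.
  by rewrite addr0 mulr1 mulNrn subrr.
by move=> a /negPf; rewrite eq_sym => ->.
Qed.

Lemma sum_agree_val_sqr x (s : 'I_n) :
  \sum_(a : 'I_q) (q%:R * (x s == a)%:R - 1) ^+ 2 = q%:R * q.-1%:R :> R.
Proof.
have q1 : q%:R = q.-1%:R + 1 :> R by rewrite -[q in LHS](prednK q_gt0) -natr1.
rewrite (bigD1 (x s))//= eqxx mulr1 (eq_bigr (fun=> 1)) => [|a /negPf].
  rewrite sumr_const cardC1 card_ord q1; ring.
by rewrite eq_sym => ->; rewrite mulr0 sub0r sqrrN expr1n.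
Qed.

(** The sum over [y] factors over the coordinates, and a coordinate lying in just one of the two
    sets contributes a zero sum. *)
Lemma sum_prod_agree_val x (S S' : {set 'I_n}) :
  \sum_(y : H) (\prod_(s in S) agree_val x y s) * (\prod_(s in S') agree_val x y s) =
  if S == S' then q%:R ^+ n * q.-1%:R ^+ #|S| else 0.
Proof.
pose v s (a : 'I_q) : R := q%:R * (x s == a)%:R - 1.
pose F s a := (if s \in S then v s a else 1) * (if s \in S' then v s a else 1).
rewrite (eq_bigr (fun y : H => \prod_s F s (y s))) => [|y _]; last first.
  by rewrite big_split /=; congr (_ * _); rewrite big_mkcond.
rewrite -(bigA_distr_bigA F); case: eqVneq => [SS'|SS'].
  rewrite (eq_bigr (fun s => q%:R * (if s \in S then q.-1%:R else 1))).
    by rewrite big_split /= prodr_const card_ord -big_mkcond prodr_const.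
  move=> s _; rewrite /F -SS'; case: ifP => _.
    by under eq_bigr do rewrite -expr2; exact: sum_agree_val_sqr.
  by rewrite mulr1 sumr_const card_ord mulr1.
have [s] : exists s, (s \in S) != (s \in S').
  apply/existsP; apply: contraR SS'; rewrite negb_exists => /forallP ss.
  by apply/eqP/setP => s; apply/eqP/negPn/ss.
rewrite (bigD1 s)//= /F; case: (s \in S); case: (s \in S') => // _.
  by under eq_bigr do rewrite mulr1; rewrite sum_agree_val mul0r.
by under eq_bigr do rewrite mul1r; rewrite sum_agree_val mul0r.
Qed.

Lemma sum_krawtchoukM x i j :
  \sum_(y : H) (krawtchouk R n q i).[(hdist x y)%:R] *
    (krawtchouk R n q j).[(hdist x y)%:R] =
  if i == j then q%:R ^+ n * (q.-1%:R ^+ i * 'C(n, i)%:R) else 0.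
Proof.
under eq_bigr do rewrite !krawtchouk_hdist mulr_suml.
rewrite exchange_big /=.
rewrite (eq_bigr (fun S : {set 'I_n} => if i == j then q%:R ^+ n * q.-1%:R ^+ i else 0)).
  rewrite sumr_const; case: eqP => _; last by rewrite mul0rn.
  have := card_draws 'I_n i; rewrite card_ord => <-.
  rewrite mulrA mulr_natr; congr (_ *+ _); apply: eq_card => S.
  by rewrite !inE.
move=> S /eqP Si.
under eq_bigr do rewrite mulr_sumr.
rewrite exchange_big /=.
under eq_bigr do rewrite sum_prod_agree_val.
case: eqP => [ij|ij].
  rewrite (bigD1 S)/= ?Si ?ij// eqxx big1 ?addr0 ?ij// => S' /andP[_].
  by rewrite eq_sym => /negPf ->.
by apply: big1 => S' /eqP S'j; case: eqP => // SS'; case: ij; rewrite -Si SS'.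
Qed.
End HammingSpace.

(** * Kernels with a finite Gram decomposition *)

Section GramKernels.
Variables (R : realType) (T : Type).
Implicit Types (F G : T -> T -> R).

(** Positive semidefiniteness is encoded by explicit features, so that the Schur product theorem
    reduces to multiplying features pairwise. *)
Definition gram F := exists s : seq (T -> R),
  forall x y, F x y = \sum_(phi <- s) phi x * phi y.

Lemma eq_gram F G : (forall x y, F x y = G x y) -> gram F -> gram G.
Proof. by move=> FG [s sF]; exists s => x y; rewrite -FG. Qed.

Lemma gram0 : gram (fun _ _ => 0).
Proof. by exists [::] => x y; rewrite big_nil. Qed.

Lemma gram_rank1 (phi : T -> R) : gram (fun x y => phi x * phi y).
Proof. by exists [:: phi] => x y; rewrite big_seq1. Qed.

Lemma gram_cst c : 0 <= c -> gram (fun _ _ => c).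
Proof.
move=> c0; apply: eq_gram (gram_rank1 (fun=> Num.sqrt c)) => x y.
by rewrite -expr2 sqr_sqrtr.
Qed.

Lemma gramD F G : gram F -> gram G -> gram (fun x y => F x y + G x y).
Proof.
by move=> [s sF] [t tG]; exists (s ++ t) => x y; rewrite big_cat /= -sF -tG.
Qed.

Lemma gramM F G : gram F -> gram G -> gram (fun x y => F x y * G x y).
Proof.
move=> [s sF] [t tG].
exists [seq (fun x => phi x * psi x) | phi <- s, psi <- t] => x y.
rewrite big_allpairs_dep sF tG mulr_suml; apply: eq_bigr => phi _.
by rewrite mulr_sumr; apply: eq_bigr => psi _; rewrite mulrACA.
Qed.

Lemma gramZ c F : 0 <= c -> gram F -> gram (fun x y => c * F x y).
Proof. by move=> c0; exact: gramM (gram_cst c0). Qed.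

Lemma gram_sum (I : Type) (r : seq I) (P : pred I) (F : I -> T -> T -> R) :
  (forall i, P i -> gram (F i)) -> gram (fun x y => \sum_(i <- r | P i) F i x y).
Proof.
move=> gF; elim: r => [|i r IH].
  by apply: eq_gram gram0 => x y; rewrite big_nil.
have [Pi|Pi] := boolP (P i).
  by apply: eq_gram (gramD (gF i Pi) IH) => x y; rewrite big_cons Pi.
by apply: eq_gram IH => x y; rewrite big_cons (negPf Pi).
Qed.

Lemma gram_prod (I : Type) (r : seq I) (P : pred I) (F : I -> T -> T -> R) :
  (forall i, P i -> gram (F i)) -> gram (fun x y => \prod_(i <- r | P i) F i x y).
Proof.
move=> gF; elim: r => [|i r IH].
  by apply: eq_gram (gram_cst ler01) => x y; rewrite big_nil.
have [Pi|Pi] := boolP (P i).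
  by apply: eq_gram (gramM (gF i Pi) IH) => x y; rewrite big_cons Pi.
by apply: eq_gram IH => x y; rewrite big_cons (negPf Pi).
Qed.

Lemma gram_sum_ge0 F (I : finType) (t : I -> T) (u : I -> R) : gram F ->
  0 <= \sum_i \sum_j u i * u j * F (t i) (t j).
Proof.
move=> [s sF].
have -> : \sum_i \sum_j u i * u j * F (t i) (t j) =
    \sum_(phi <- s) (\sum_i u i * phi (t i)) ^+ 2.
  under eq_bigr do under eq_bigr do rewrite sF mulr_sumr.
  under eq_bigr do rewrite exchange_big /=.
  rewrite exchange_big /=; apply: eq_bigr => phi _.
  rewrite expr2 mulr_suml; apply: eq_bigr => i _.
  by rewrite mulr_sumr; apply: eq_bigr => j _; rewrite mulrACA.
by apply: sumr_ge0 => phi _; exact: sqr_ge0.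
Qed.
End GramKernels.

(** * Gram decompositions of the Krawtchouk kernels *)

Section HammingGram.
Variables (R : realType) (n q : nat).
Hypothesis q_gt0 : (0 < q)%N.
Local Notation H := (hamming n q).

Lemma gram_agree (s : 'I_n) : gram (fun x y : H => (x s == y s)%:R : R).
Proof.
apply: (@eq_gram _ _ (fun x y : H => \sum_(a : 'I_q) (x s == a)%:R * (y s == a)%:R)).
  move=> x y; rewrite (bigD1 (x s))//= eqxx mul1r big1 ?addr0 1?eq_sym// => a.
  by rewrite eq_sym => /negPf ->; rewrite mul0r.
by apply: gram_sum => a _; exact: gram_rank1.
Qed.

Lemma gram_agree_val (s : 'I_n) : gram (fun x y : H => agree_val R x y s).
Proof.
(* Letter indicators centred to mean zero; their Gram kernel is [[x_s = y_s] - 1 / q]. *)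
pose phi (a : 'I_q) (x : H) : R := (x s == a)%:R - q%:R^-1.
have q0 : q%:R != 0 :> R by rewrite pnatr_eq0 -lt0n.
have sphi (x : H) : \sum_a (x s == a)%:R = 1 :> R.
  rewrite (bigD1 (x s))//= eqxx big1 ?addr0// => a.
  by rewrite eq_sym => /negPf ->.
apply: (@eq_gram _ _ (fun x y : H => q%:R * \sum_a phi a x * phi a y)).
  move=> x y; have -> : \sum_a phi a x * phi a y = \sum_a (x s == a)%:R * (y s == a)%:R
      - q%:R^-1 * \sum_a (x s == a)%:R - q%:R^-1 * \sum_a (y s == a)%:R
      + \sum_(a : 'I_q) q%:R^-1 ^+ 2.
    rewrite !mulr_sumr -!sumrB -big_split /=; apply: eq_bigr => a _.
    by rewrite /phi; ring.
  rewrite !sphi sumr_const card_ord.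
  have -> : q%:R^-1 ^+ 2 *+ q = q%:R^-1 ^+ 2 * q%:R :> R by rewrite mulr_natr.
  rewrite (bigD1 (x s))//= eqxx mul1r big1 ?addr0; last first.
    by move=> a; rewrite eq_sym => /negPf ->; rewrite mul0r.
  by rewrite /agree_val eq_sym; field.
have gs : gram (fun x y : H => \sum_a phi a x * phi a y).
  by apply: gram_sum => a _; exact: gram_rank1.
exact: (gramZ (ler0n R q) gs).
Qed.

Lemma gram_krawtchouk i :
  gram (fun x y : H => (krawtchouk R n q i).[(hdist x y)%:R]).
Proof.
apply: (@eq_gram _ _ (fun x y : H => elem_sym (agree_val R x y) i)).
  by move=> x y; rewrite krawtchouk_hdist.
apply: gram_sum => S _; apply: gram_prod => s _; exact: gram_agree_val.
Qed.

(* Where x and y agree at s, d(x, y) is a distance in the space of length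
   n - 1 obtained by deleting the coordinate s. *)
Lemma gram_agree_krawtchouk (s : 'I_n) i :
  gram (fun x y : H => (x s == y s)%:R * (krawtchouk R n.-1 q i).[(hdist x y)%:R]).
Proof.
pose v (x y : H) r : R := if r \in [set~ s]%SET then agree_val R x y r else 0.
apply: (@eq_gram _ _ (fun x y : H => (x s == y s)%:R * elem_sym (v x y) i)).
  move=> x y; case: eqP => [xy|]; last by rewrite !mul0r.
  have := @krawtchouk_elem_sym R n q q_gt0 [set~ s] x y i; rewrite cardsC1 card_ord => <-.
  congr (_ * _.[_%:R]); apply: eq_card => r; rewrite !inE.
  by have [->|//] := eqVneq r s; rewrite xy eqxx.
apply: gramM (gram_agree s) _.
apply: gram_sum => S _; apply: gram_prod => r _; rewrite /v.
by case: (r \in _); [exact: gram_agree_val|exact: gram0].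
Qed.
End HammingGram.

(** * Means and the Rao bound *)

Section RaoArithmetic.
Variable q : nat.
Hypothesis q_gt0 : (0 < q)%N.

Definition ball_card (n j : nat) : nat := \sum_(i < j.+1) 'C(n, i) * q.-1 ^ i.

Lemma ball_cardS n j :
  ball_card n.+1 j.+1 = (ball_card n j.+1 + q.-1 * ball_card n j)%N.
Proof.
rewrite /ball_card big_ord_recl [in RHS]big_ord_recl !bin0 -addnA; congr (_ + _)%N.
rewrite big_distrr -big_split /=; apply: eq_bigr => i _.
by rewrite /bump /= !add1n binS expnS; lia.
Qed.

Lemma leq_ball_card n i j : (i <= j)%N -> (ball_card n i <= ball_card n j)%N.
Proof.
move=> /subnKC <-; elim: (j - i)%N => [|d IH]; first by rewrite addn0.
by apply: (leq_trans IH); rewrite addnS /ball_card [leqRHS]big_ord_recr leq_addr.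
Qed.

Lemma ball_card_full n : ball_card n n = (q ^ n)%N.
Proof.
rewrite -[q in RHS](prednK q_gt0) -addn1 addnC expnDn; apply: eq_bigr => i _.
by rewrite exp1n mul1n mulnC.
Qed.

Lemma ball_card_le n j : (ball_card n j <= q ^ n)%N.
Proof.
have [jn|/ltnW nj] := leqP j n; first by rewrite -ball_card_full leq_ball_card.
rewrite -ball_card_full -(subnKC nj).
elim: (j - n)%N => [|d IH]; first by rewrite addn0.
rewrite addnS /ball_card [leqLHS]big_ord_recr /= bin_small ?mul0n ?addn0//.
by rewrite ltnS leq_addr.
Qed.

Lemma raoE n tau : rao n q tau =
  if odd tau then (q * ball_card n.-1 tau./2)%N else ball_card n tau./2.
Proof. by rewrite /rao uphalf_half; case: odd. Qed.

(** Puts [M] in the range that [M_bounds] of the quadrature section requires for the kernels of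
    length [n], with [k = tau./2 + 1]. The lower bound follows from Pascal's rule; [k > n] would
    push [M] above [q ^ n]. *)
Lemma rao_odd_bounds n tau M : (0 < n)%N -> odd tau ->
  (rao n q tau < M <= rao n q tau.+1)%N ->
  (tau./2 < n)%N /\ (ball_card n tau./2 < M <= ball_card n tau./2.+1)%N.
Proof.
case: n => // n _ ot; rewrite !raoE ot /= ot /= uphalf_half ot add1n => /andP[M1 M2].
have le : (ball_card n.+1 tau./2 <= q * ball_card n tau./2)%N.
  case: (tau./2) => [|j].
    by rewrite /ball_card !big_ord1 !bin0 expn0 !muln1.
  rewrite ball_cardS -[q in leqRHS](prednK q_gt0) mulSn leq_add2l leq_mul2l.
  by rewrite leq_ball_card ?orbT.
split; last by rewrite M2 (leq_ltn_trans le M1).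
rewrite ltnNge; apply/negP => nt.
have := leq_trans M1 (leq_trans M2 (ball_card_le _ _)).
by rewrite ltnNge expnS leq_mul2l -ball_card_full leq_ball_card ?orbT// ltnW.
Qed.

(** The same for [M / q] and the kernels of length [n - 1], with [k = tau./2]. *)
Lemma rao_even_bounds n tau M : (0 < n)%N -> (0 < tau)%N -> ~~ odd tau ->
  (rao n q tau < M <= rao n q tau.+1)%N ->
  (tau./2 <= n.-1)%N /\
  (q * ball_card n.-1 (tau./2).-1 < M <= q * ball_card n.-1 tau./2)%N.
Proof.
case: n => // n _ t0 ot; rewrite !raoE /= (negPf ot) /= uphalf_half (negPf ot) add0n.
move=> /andP[M1 M2]; have : (0 < tau./2)%N by rewrite half_gt0; lia.
case: (tau./2) M1 M2 => // k M1 M2 _ /=.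
split; last first.
  rewrite M2 andbT (leq_ltn_trans _ M1)// ball_cardS -[q in leqLHS](prednK q_gt0) mulSn.
  by rewrite leq_add2r leq_ball_card.
rewrite leqNgt; apply/negP => nk; have := leq_trans M1 M2.
rewrite ltnNge => /negP; apply.
rewrite (leq_trans (leq_mul (leqnn q) (ball_card_le n k.+1)))// -expnS -ball_card_full.
exact: leq_ball_card.
Qed.
End RaoArithmetic.

(** * Means over the Hamming space and deletion of a coordinate *)

Section Means.
Variables (R : realType) (q : nat).
Hypothesis q_gt0 : (0 < q)%N.

(** The scale [s] is kept apart from the length, so that words of length [n - 1] can be averaged at
    the arguments [1 - 2 z / n]. At [s = n] this is [mean_coef]. *)
Definition mean_at n (s : R) (f : {poly R}) : R :=
  (q%:R ^+ n)^-1 *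
  \sum_(z < n.+1) 'C(n, z)%:R * q.-1%:R ^+ z * f.[1 - 2 * z%:R / s].

Fact mean_at_is_linear n s : scalar (mean_at n s).
Proof.
move=> a f g; rewrite /mean_at /= mulrCA -mulrDr; congr (_ * _).
rewrite mulr_sumr -big_split /=.
by apply: eq_bigr => z _; rewrite hornerD hornerZ; ring.
Qed.

HB.instance Definition _ n s :=
  GRing.isLinear.Build R {poly R} R _ (mean_at n s) (mean_at_is_linear n s).

Let q_neq0 : q%:R != 0 :> R.
Proof. by rewrite pnatr_eq0 -lt0n. Qed.

Lemma mean_at_hamming n (s : R) f (x : hamming n q) :
  mean_at n s f = (q%:R ^+ n)^-1 * \sum_(y : hamming n q) f.[1 - 2 * (hdist x y)%:R / s].
Proof. by rewrite (sum_hdist x (fun z => f.[1 - 2 * z%:R / s])). Qed.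

Lemma mean_at_kraw_polyM n (s : R) i j : s != 0 ->
  mean_at n s (kraw_poly q n s i * kraw_poly q n s j) =
  if i == j then (kraw_poly q n s i).[1] else 0.
Proof.
move=> s0; rewrite (mean_at_hamming _ _ [ffun=> Ordinal q_gt0]).
under eq_bigr do rewrite hornerM !horner_kraw_poly//.
rewrite sum_krawtchoukM// horner_kraw_poly1//; case: eqP => _; last by rewrite mulr0.
by rewrite mulKf// expf_neq0.
Qed.

Lemma horner_kernel_poly1 n (s : R) j :
  (kernel_poly (kraw_poly q n s) j).[1] = (ball_card q n j)%:R.
Proof.
rewrite horner_sum natr_sum; apply: eq_bigr => i _.
by rewrite horner_kraw_poly1 natrM natrX mulrC.
Qed.

Lemma quadrature_node_poly n (s : R) k (x w : nat -> R) (M : R) :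
  0 < s -> (0 < k <= n)%N ->
  (forall i j, (i < j)%N -> (j < k)%N -> x i < x j) ->
  (forall i, (i < k)%N -> x i < 1) ->
  (forall i, (i < k)%N -> 0 < w i) -> 0 < M ->
  (ball_card q n k.-1)%:R < M <= (ball_card q n k)%:R ->
  (forall f : {poly R}, (size f <= 2 * k)%N ->
     mean_at n s f = f.[1] / M + \sum_(i < k) w i * f.[x i]) ->
  forall m, (m <= k)%N -> exists c : nat -> R, (forall j, (j <= m)%N -> 0 <= c j) /\
    node_poly x m = \sum_(j < m.+1) c j *: kernel_poly (kraw_poly q n s) j.
Proof.
move=> s0 /andP[k0 kn] xi x1 w0 M0 Mb ex m mk.
apply: (@node_poly_kernel_poly R (mean_at n s) _ n k x w M) => //.
- by move=> i _; have [] := kraw_poly_lead q_gt0 n i s0.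
- by move=> i _; have [] := kraw_poly_lead q_gt0 n i s0.
- by move=> i j _ _; rewrite /= mean_at_kraw_polyM// gt_eqF.
- by rewrite !horner_kernel_poly1.
Qed.

(* Turns a quadrature rule of degree 2 k on length n + 1 with the node -1 into one of
   degree 2 k - 1 on length n without it, M being replaced by M / q. *)
Lemma mean_at_delete n (f : {poly R}) :
  mean_at n n.+1%:R f = q%:R / 2 * mean_at n.+1 n.+1%:R ((1 + 'X) * f).
Proof.
have n0 : n.+1%:R != 0 :> R by rewrite pnatr_eq0.
rewrite /mean_at [in RHS]big_ord_recr /=.
have -> : ((1 + 'X) * f).[1 - 2 * n.+1%:R / n.+1%:R] = 0.
  by rewrite hornerM hornerD hornerX hornerC mulfK//; ring.
rewrite mulr0 addr0 exprS mulrA; set c := q%:R / 2 * _.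
have -> : c = (q%:R ^+ n)^-1 / 2.
  by rewrite /c; field; rewrite expf_neq0 ?q_neq0.
rewrite -mulrA; congr (_ * _); rewrite mulr_sumr; apply: eq_bigr => z _.
have zn : (z <= n)%N by rewrite -ltnS.
(* At [t = 1 - 2 z / (n + 1)] the factor [1 + t] equals [2 (n + 1 - z) / (n + 1)], and this identity
   lets it absorb the change of binomial coefficient. *)
have cE : ('C(n, z))%:R = 'C(n.+1, z)%:R * (n.+1%:R - z%:R) / n.+1%:R :> R.
  rewrite -natrB ?leqW// -natrM; apply: (canRL (mulfK n0)).
  by rewrite -natrM mulnC [in RHS]mulnC -mul_bin_down.
by rewrite cE hornerM hornerD hornerX hornerC; field.
Qed.
End Means.

(** * Absolutely monotone functions and Hermite interpolation *)

Section AbsolutelyMonotone.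
Variable R : realType.
Implicit Types (f : R -> R) (hd : nat -> R -> R) (x y t : R).

Local Notation D := [set t : R | -1 <= t < 1].

Definition cont_at f x := f t @[t --> within D (nbhs x)] --> f x.

Lemma cont_atP f x : cont_at f x <-> forall e, 0 < e ->
  exists2 d, 0 < d & forall t, -1 <= t < 1 -> `|t - x| < d -> `|f t - f x| < e.
Proof.
split=> [/cvgrPdist_lt fx e e0|fx].
  have /nbhs_ballP[d d0 dP] := fx e e0.
  exists d => // t Dt tx; rewrite distrC; apply: dP => //.
  by rewrite /ball /= distrC.
apply/cvgrPdist_lt => e e0; have [d d0 dP] := fx e e0.
apply/nbhs_ballP; exists d => //= t; rewrite /ball /= distrC => tx Dt.
by rewrite distrC; apply: dP.
Qed.

Definition between x y t := (x < t < y) || (y < t < x).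

Lemma between_dom x y t : -1 <= x < 1 -> -1 <= y < 1 -> between x y t -> -1 < t < 1.
Proof. by move=> /andP[? ?] /andP[? ?] /orP[]/andP[? ?]; lra. Qed.

Lemma between_dist x y t : between x y t -> `|t - x| < `|y - x|.
Proof.
case/orP=> /andP[xt ty].
  by rewrite !gtr0_norm ?subr_gt0//; lra.
by rewrite !ltr0_norm ?subr_lt0//; lra.
Qed.

Lemma mvt_between f df x y : x != y -> -1 <= x < 1 -> -1 <= y < 1 ->
  (forall t, -1 <= t < 1 -> cont_at f t) ->
  (forall t, between x y t -> is_derive t 1 f (df t)) ->
  exists2 t, between x y t & f y - f x = df t * (y - x).
Proof.
wlog xy : x y / x < y => [wl xy Dx Dy cf df'|_ Dx Dy cf df'].
  move: (xy); rewrite neq_lt => /orP[xy'|yx]; first exact: wl.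
  have [||t yt E] := wl y x yx _ Dy Dx cf; first by rewrite eq_sym.
    by move=> t yt; apply: df'; rewrite /between orbC.
  by exists t; [rewrite /between orbC|rewrite -opprB E; ring].
have [||t] := @MVT R f df x y xy.
- move=> t; rewrite in_itv /= => xty; apply: df'; by rewrite /between xty.
- apply/subspace_continuousP => t /=; rewrite in_itv /= => xty.
  have Dt : -1 <= t < 1 by move: Dx Dy xty => /andP[? ?] /andP[? ?] /andP[? ?]; lra.
  apply: cvg_trans (cf t Dt); apply: cvg_app; apply: within_subset => s /=.
  rewrite in_itv /= => /andP[? ?].
  by move: Dx Dy => /andP[? ?] /andP[? ?]; lra.
by rewrite in_itv /= => xty E; exists t => //; rewrite /between xty.
Qed.

(* Continuity replaces the one-sided derivative at -1. *)
Record abs_monotone hd : Prop := AbsMonotone {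
  abm_cont : forall m x, -1 <= x < 1 -> cont_at (hd m) x;
  abm_derive : forall m x, -1 < x < 1 -> is_derive x 1 (hd m) (hd m.+1 x);
  abm_gt0 : forall m x, -1 <= x < 1 -> 0 < hd m x }.

Lemma nbhs_dom x : -1 < x < 1 -> nbhs x D.
Proof.
move=> /andP[x1 x2].
apply: (@filterS _ _ _ `]-1, 1[%classic).
  by move=> t /=; rewrite in_itv /= => /andP[? ?]; lra.
by apply: open_nbhs_nbhs; split; [exact: interval_open|rewrite /= in_itv /= x1].
Qed.

Lemma has_derivative_on_cont f df x : has_derivative_on D f df -> -1 <= x < 1 ->
  cont_at f x.
Proof.
move=> /(_ x) fx Dx; have {}fx := fx Dx; apply/cont_atP => e e0.
have /cvgrPdist_lt/(_ 1 ltr01)/nbhs_ballP[d d0 dP] := fx.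
(* A bound for the difference quotients close to [x]. *)
pose c := `|df x| + 1.
have c0 : 0 < c by rewrite ltr_wpDl.
exists (Num.min d (e / c)); first by rewrite lt_min d0 divr_gt0.
move=> t Dt; rewrite lt_min => /andP[td te].
have [->|tx] := eqVneq t x; first by rewrite subrr normr0.
have := dP t; rewrite /ball /= distrC => /(_ td tx Dt).
set r := _ / _ => dr.
have -> : f t - f x = r * (t - x) by rewrite divfK// subr_eq0.
have rc : `|r| < c.
  rewrite /c -[r](subKr (df x)) (le_lt_trans (ler_normB _ _))// ltrD2l//.
rewrite normrM; apply: le_lt_trans (_ : c * `|t - x| < e).
  by rewrite ler_wpM2r// ltW.
by rewrite mulrC -ltr_pdivlMr.
Qed.

Lemma has_derivative_on_is_derive f df x : has_derivative_on D f df -> -1 < x < 1 ->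
  is_derive x 1 f (df x).
Proof.
move=> fx x1; have Dx : -1 <= x < 1 by move: x1 => /andP[? ?]; lra.
apply/is_derive1_caratheodory.
exists (fun t => if t == x then df x else (f t - f x) / (t - x)); split.
- move=> z; case: eqP => [->|/eqP zx]; first by rewrite !subrr mulr0.
  by rewrite divfK// subr_eq0.
- apply/continuous_withinNx; rewrite eqxx.
  have {}fx := fx x Dx.
  apply/cvgrPdist_lt => e e0.
  have /cvgrPdist_lt/(_ e e0)/nbhs_ballP[d d0 dP] := fx.
  have /nbhs_ballP[d' d'0 d'P] := nbhs_dom x1.
  apply/nbhs_ballP; exists (Num.min d d'); first by rewrite /= lt_min d0.
  move=> t; rewrite /ball /= lt_min => /andP[td td'] tx.
  by rewrite (negPf tx); apply: dP => //; apply: d'P.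
- by rewrite eqxx.
Qed.

Lemma strictly_absolutely_monotoneP h : strictly_absolutely_monotone h ->
  exists2 hd, abs_monotone hd & forall t, -1 <= t < 1 -> hd 0%N t = h t.
Proof.
move=> [hd [h0 hD hp]]; exists hd => //; split=> // m x.
  exact: has_derivative_on_cont (hD m).
exact: has_derivative_on_is_derive (hD m).
Qed.

Lemma abs_monotone_le hd m x y : abs_monotone hd -> -1 <= x -> x <= y -> y < 1 ->
  hd m x <= hd m y.
Proof.
move=> [hc hD hp] x1; rewrite le_eqVlt => /predU1P[->//|xy] y1.
have Dx : -1 <= x < 1 by rewrite x1 (lt_trans xy).
have Dy : -1 <= y < 1 by rewrite (le_trans x1 (ltW xy)).
have [||t xt E] := @mvt_between (hd m) (hd m.+1) x y _ Dx Dy (hc m).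
- by rewrite lt_eqF.
- by move=> t xt; apply: hD; exact: between_dom xt.
have /andP[t1 t2] := between_dom Dx Dy xt.
rewrite -subr_ge0 E mulr_ge0 ?subr_ge0 ?(ltW xy)// ltW// hp//; lra.
Qed.

(* ddiff hd y m is the m-th derivative of (hd 0 t - hd 0 y) / (t - y), and
   taylor_num hd y m t = (t - y)^(m + 1) * ddiff hd y m t. *)
Fixpoint taylor_num hd y m t : R :=
  if m is m'.+1 then (t - y) ^+ m * hd m t - m%:R * taylor_num hd y m' t
  else hd 0%N t - hd 0%N y.

Definition ddiff hd y m t : R :=
  if t == y then hd m.+1 y / m.+1%:R else taylor_num hd y m t / (t - y) ^+ m.+1.

Lemma taylor_num_eq0 hd y m : taylor_num hd y m y = 0.
Proof.
elim: m => [|m IH] /=; first by rewrite subrr.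
by rewrite IH subrr expr0n /= mul0r mulr0 subrr.
Qed.

Lemma is_derive_subX y m x :
  is_derive x 1 (fun t => (t - y) ^+ m.+1) (m.+1%:R * (x - y) ^+ m).
Proof.
have -> : (fun t => (t - y) ^+ m.+1) = horner (('X - y%:P) ^+ m.+1).
  by apply/funext => t; rewrite horner_exp hornerXsubC.
apply: is_derive_eq.
by rewrite deriv_exp derivXsubC mul1r hornerMn horner_exp hornerXsubC mulr_natl.
Qed.

Lemma cont_subX y m x : cont_at (fun t => (t - y) ^+ m) x.
Proof.
apply: cvg_within_filter.
have E t : (t - y) ^+ m = (('X - y%:P) ^+ m).[t] by rewrite horner_exp hornerXsubC.
rewrite E; under eq_fun do rewrite E.
exact: continuous_horner.
Qed.

(** The product rule yields a term with [hd m] that cancels the derivative of the preceding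
    numerator, by the design of the recursion. *)
Lemma taylor_num_derive hd y m x : abs_monotone hd -> -1 < x < 1 ->
  is_derive x 1 (taylor_num hd y m) ((x - y) ^+ m * hd m.+1 x).
Proof.
move=> [hc hD hp] x1; elim: m => [|m IH].
  rewrite expr0 mul1r -[X in is_derive _ _ _ X]subr0.
  have := hD 0%N x x1 => ?.
  exact: is_deriveB.
have d1 := hD m.+1 x x1.
have d2 := is_derive_subX y m x.
rewrite [X in is_derive _ _ X _](_ : _ = (fun t => (t - y) ^+ m.+1) * hd m.+1
   - m.+1%:R *: taylor_num hd y m)//.
apply: is_derive_eq.
by rewrite /GRing.scale /=; ring.
Qed.

Lemma taylor_num_cont hd y m x : abs_monotone hd -> -1 <= x < 1 ->
  cont_at (taylor_num hd y m) x.
Proof.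
move=> [hc hD hp] Dx; elim: m => [|m IH].
  by apply: cvgB; [exact: hc|exact: cvg_cst].
apply: cvgB; last by apply: cvgM => //; exact: cvg_cst.
by apply: cvgM; [exact: cont_subX|exact: hc].
Qed.

(* Cauchy's mean value theorem for taylor_num and (t - y)^(m + 1). *)
Lemma ddiff_mvt hd y m t : abs_monotone hd -> -1 <= y < 1 -> -1 <= t < 1 -> t != y ->
  exists2 xi, between y t xi & ddiff hd y m t = hd m.+1 xi / m.+1%:R.
Proof.
move=> H Dy Dt ty; pose c := taylor_num hd y m t; pose e := (t - y) ^+ m.+1.
have e0 : e != 0 by rewrite expf_neq0// subr_eq0.
pose phi := (e *: taylor_num hd y m - c *: (fun s => (s - y) ^+ m.+1)) : R -> R.
pose dphi x := (x - y) ^+ m * (e * hd m.+1 x - c * m.+1%:R).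
have [|||xi yt] := @mvt_between phi dphi y t _ Dy Dt.
- by rewrite eq_sym.
- move=> s Ds; apply: cvgB; apply: cvgM; try exact: cvg_cst.
    exact: taylor_num_cont.
  exact: cont_subX.
- move=> s /(between_dom Dy Dt) s1.
  have d1 := taylor_num_derive y m H s1.
  have d2 := is_derive_subX y m s.
  by apply: is_derive_eq; rewrite /dphi /GRing.scale /=; ring.
have -> : phi t = 0 by rewrite /phi /c /e; rewrite -[LHS]/(e * c - c * e); ring.
have -> : phi y = 0.
  rewrite -[LHS]/(e * taylor_num hd y m y - c * (y - y) ^+ m.+1).
  by rewrite taylor_num_eq0 subrr expr0n /= !mulr0 subrr.
rewrite subrr => /esym/eqP; rewrite mulf_eq0 subr_eq0 (negPf ty) orbF mulf_eq0.
have xiy : xi != y by move: yt; rewrite /between => /orP[]/andP[? ?]; lra.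
rewrite expf_eq0 subr_eq0 (negPf xiy) andbF /= subr_eq0 => /eqP E.
exists xi => //; rewrite /ddiff (negPf ty) -/c -/e.
have m0 : m.+1%:R != 0 :> R by rewrite pnatr_eq0.
by apply/eqP; rewrite eqr_div// -E mulrC.
Qed.

Lemma ddiff_gt0 hd y m t : abs_monotone hd -> -1 <= y < 1 -> -1 <= t < 1 ->
  0 < ddiff hd y m t.
Proof.
move=> H Dy Dt; have [->|ty] := eqVneq t y.
  by rewrite /ddiff eqxx divr_gt0// (abm_gt0 H).
have [xi yt ->] := ddiff_mvt m H Dy Dt ty.
rewrite divr_gt0// (abm_gt0 H)//.
by have /andP[? ?] := between_dom Dy Dt yt; lra.
Qed.

(** At [y] itself, [ddiff_mvt] writes the quotient as a derivative at an intermediate point, which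
    converges by continuity of [hd m.+1]. *)
Lemma ddiff_cont hd y m x : abs_monotone hd -> -1 <= y < 1 -> -1 <= x < 1 ->
  cont_at (ddiff hd y m) x.
Proof.
move=> H Dy Dx; have [xy|xy] := eqVneq x y.
  rewrite xy; apply/cont_atP => e e0.
  have /cont_atP/(_ e e0)[d d0 dP] := @abm_cont _ H m.+1 _ Dy.
  exists d => // t Dt td; have [->|ty] := eqVneq t y; first by rewrite subrr normr0.
  have [xi yt ->] := ddiff_mvt m H Dy Dt ty.
  rewrite /ddiff eqxx -mulrBl normrM.
  apply: le_lt_trans (_ : `|hd m.+1 xi - hd m.+1 y| < e).
    by rewrite ler_piMr// ger0_norm ?invr_ge0// invf_le1 ?ler1n ?ltr0n.
  apply: dP; first by have /andP[? ?] := between_dom Dy Dt yt; lra.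
  exact: lt_trans (between_dist yt) td.
rewrite /cont_at {2}/ddiff (negPf xy).
apply: cvg_trans
  (_ : (fun t => taylor_num hd y m t / (t - y) ^+ m.+1) @ within D (nbhs x) --> _).
  apply: near_eq_cvg; apply: cvg_within; apply: filterS (_ : nbhs x [set t | t != y]).
    by move=> t /= ty; rewrite /ddiff (negPf ty).
  by apply: open_nbhs_nbhs; split => //; exact: open_neq.
apply: cvgM; first exact: taylor_num_cont.
apply: cvgV; first by rewrite expf_neq0// subr_eq0.
exact: cont_subX.
Qed.

Lemma ddiff_derive_neq hd y m x : abs_monotone hd -> -1 < x < 1 -> x != y ->
  is_derive x 1 (ddiff hd y m) (ddiff hd y m.+1 x).
Proof.
move=> H x1 xy.
apply: (@near_eq_is_derive _ _ _ (taylor_num hd y m * (fun t => ((t - y) ^+ m.+1)^-1))).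
  apply: filterS (_ : nbhs x [set t | t != y]).
    by move=> t /= ty; rewrite /ddiff (negPf ty).
  by apply: open_nbhs_nbhs; split => //; exact: open_neq.
have d1 := taylor_num_derive y m H x1.
have d2 := is_derive_subX y m x.
have e0 : (x - y) ^+ m.+1 != 0 by rewrite expf_neq0// subr_eq0.
have d3 := @is_deriveV _ (fun t => (t - y) ^+ m.+1) _ _ _ e0 d2.
apply: is_derive_eq.
rewrite /ddiff (negPf xy) /GRing.scale /= !exprS; field.
by rewrite expf_neq0 subr_eq0.
Qed.

(** By the mean value theorem the difference quotient at [y] is [ddiff hd y m.+1] at an intermediate
    point, and that function is continuous at [y]. *)
Lemma ddiff_derive_eq hd y m : abs_monotone hd -> -1 < y < 1 ->
  is_derive y 1 (ddiff hd y m) (ddiff hd y m.+1 y).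
Proof.
move=> H y1; have Dy : -1 <= y < 1 by move: y1 => /andP[? ?]; lra.
pose G := ddiff hd y.
apply/is_derive1_caratheodory.
exists (fun t => if t == y then G m.+1 y else (G m t - G m y) / (t - y)); split.
- move=> z; case: eqP => [->|/eqP zx]; first by rewrite !subrr mulr0.
  by rewrite divfK// subr_eq0.
- apply/continuous_withinNx; rewrite eqxx; apply/cvgrPdist_lt => e e0.
  have /cont_atP/(_ e e0)[d d0 dP] := @ddiff_cont hd y m.+1 y H Dy Dy.
  have /nbhs_ballP[d' d'0 d'P] := nbhs_dom y1.
  apply/nbhs_ballP; exists (Num.min d d'); first by rewrite /= lt_min d0.
  move=> t; rewrite /ball /= lt_min => /andP[td td'] ty.
  have Dt : -1 <= t < 1 by exact: d'P.
  rewrite (negPf ty).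
  have [||t' yt'|xi yt ->] := @mvt_between (G m) (G m.+1) y t _ Dy Dt.
  + by rewrite eq_sym.
  + by move=> s Ds; exact: ddiff_cont.
  + apply: ddiff_derive_neq => //; first exact: between_dom yt'.
    by move: yt'; rewrite /between => /orP[]/andP[? ?]; lra.
  rewrite mulfK ?subr_eq0// distrC; apply: dP.
    by have /andP[? ?] := between_dom Dy Dt yt; lra.
  by rewrite (lt_trans (between_dist yt))// distrC.
- by rewrite eqxx.
Qed.

Lemma abs_monotone_ddiff hd y : abs_monotone hd -> -1 <= y < 1 ->
  abs_monotone (ddiff hd y).
Proof.
move=> H Dy; split=> m x Dx; [exact: ddiff_cont| |exact: ddiff_gt0].
have [xy|xy] := eqVneq x y; last exact: ddiff_derive_neq.
by rewrite xy in Dx *; exact: ddiff_derive_eq.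
Qed.

Lemma ddiffE hd y t : hd 0%N t = hd 0%N y + (t - y) * ddiff hd y 0 t.
Proof.
rewrite /ddiff; case: eqVneq => [->|ty]; first by rewrite subrr mul0r addr0.
by rewrite expr1 mulrC divfK ?subr_eq0//= addrC subrK.
Qed.
End AbsolutelyMonotone.

(** * Hermite interpolation in Newton form *)

Section Hermite.
Variable R : realType.

Lemma node_polyS (x : nat -> R) m :
  node_poly x m.+1 = ('X - (x 0%N)%:P) * node_poly (fun i => x i.+1) m.
Proof. by rewrite /node_poly big_ord_recl. Qed.

Lemma node_poly_root (x : nat -> R) k i : (i < k)%N -> (node_poly x k).[x i] = 0.
Proof.
move=> ik; rewrite horner_prod (bigD1 (Ordinal ik))//=.
by rewrite hornerXsubC subrr mul0r.
Qed.

(* Newton form with the nodes x 0, x 0, x 1, x 1, and so on. *)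
Definition newton_form (x a b : nat -> R) k : {poly R} :=
  \sum_(m < k) (a m *: (node_poly x m * node_poly x m) +
                b m *: (node_poly x m * node_poly x m.+1)).

Lemma size_newton_form (x a b : nat -> R) k : (size (newton_form x a b k) <= 2 * k)%N.
Proof.
apply: (leq_trans (size_sum _ _ _)); apply/bigmax_leqP => m _.
have mk := ltn_ord m.
apply: (leq_trans (size_polyD _ _)); rewrite geq_max; apply/andP; split;
  apply: (leq_trans (size_scale_leq _ _)); apply: (leq_trans (size_polyMleq _ _));
  rewrite !size_node_poly; lia.
Qed.

(** Two divided differences at the first node leave an absolutely monotone function, to which the
    induction applies with the remaining nodes. The values split off are the Newton coefficients,
    and the last function left is the remainder [r]. *)
Lemma hermite_double (hd : nat -> R -> R) k (x : nat -> R) : abs_monotone hd ->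
  (forall i, (i < k)%N -> -1 <= x i < 1) ->
  exists a b : nat -> R, exists r : R -> R,
    [/\ forall m, (m < k)%N -> 0 <= a m /\ 0 <= b m,
        forall t, -1 <= t < 1 -> 0 <= r t &
        forall t, -1 <= t < 1 ->
          hd 0%N t = (newton_form x a b k).[t] + (node_poly x k).[t] ^+ 2 * r t].
Proof.
elim: k hd x => [|k IH] hd x H Dx.
  exists (fun=> 0), (fun=> 0), (hd 0%N); split=> // t Dt.
    exact/ltW/(abm_gt0 H).
  by rewrite /newton_form /node_poly !big_ord0 horner0 hornerC add0r expr1n mul1r.
pose y := x 0%N; have Dy : -1 <= y < 1 by exact: Dx.
have H1 := abs_monotone_ddiff H Dy; have H2 := abs_monotone_ddiff H1 Dy.
have [i ik|a [b [r [ab r0 hE]]]] := IH _ (fun i => x i.+1) H2; first exact: Dx.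
exists (fun m => if m is m'.+1 then a m' else hd 0%N y).
exists (fun m => if m is m'.+1 then b m' else ddiff hd y 0%N y), r.
split=> // [[|m] mk|t Dt].
- by split; [exact/ltW/(abm_gt0 H)|exact/ltW/(abm_gt0 H1)].
- exact: ab.
rewrite (ddiffE hd y t) (ddiffE (ddiff hd y) y t) hE//.
have -> : newton_form x (fun m => if m is m'.+1 then a m' else hd 0%N y)
    (fun m => if m is m'.+1 then b m' else ddiff hd y 0%N y) k.+1 =
  (hd 0%N y)%:P + (ddiff hd y 0%N y) *: ('X - y%:P) +
  ('X - y%:P) ^+ 2 * newton_form (fun i => x i.+1) a b k.
  have g0 z : node_poly z 0 = 1 :> {poly R} by exact: big_ord0.
  rewrite /newton_form big_ord_recl /= !node_polyS -/y !g0 !mulr1 !mul1r.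
  rewrite alg_polyC; congr (_ + _); rewrite mulr_sumr.
  apply: eq_bigr => i _; rewrite /bump /= !add1n node_polyS [node_poly x _.+2]node_polyS -/y.
  by rewrite mulrDr -!scalerAr; congr (_ *: _ + _ *: _); ring.
rewrite node_polyS -/y !(hornerXsubC, hornerD, hornerM, hornerZ, hornerC, horner_exp).
ring.
Qed.

Lemma horner_bound (p : {poly R}) t : -1 <= t < 1 ->
  `|p.[t]| <= \sum_(i < size p) `|p`_i|.
Proof.
move=> Dt; rewrite horner_coef (le_trans (ler_norm_sum _ _ _))//.
apply: ler_sum => i _; rewrite normrM normrX ler_piMr// exprn_ile1//.
by rewrite ler_norml; move: Dt => /andP[-> /ltW].
Qed.

(** Only derivatives of order below [size p] impose a condition. As [hd m] is increasing, its value
    at [-1] is its minimum, to be compared with the bound [B m] for the derivative of [p]. *)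
Lemma abs_monotone_sub (hd : nat -> R -> R) (p : {poly R}) : abs_monotone hd ->
  exists2 e, 0 < e & abs_monotone (fun m t => hd m t - e * (p^`(m)).[t]).
Proof.
move=> H; pose B m : R := \sum_(i < size p^`(m)) `|p^`(m)`_i|.
have D1 : -1 <= (-1 : R) < 1 by lra.
have B0 m : 0 <= B m by rewrite sumr_ge0.
have hd0 m : 0 < hd m (-1) by exact: (abm_gt0 H).
(* Makes [c^-1 * B m < hd m (-1)] for all [m < size p] at once; the summand 1 gives strictness. *)
pose c := 1 + \sum_(m < size p) B m / hd m (-1).
have c0 : 0 < c.
  by rewrite ltr_wpDr// sumr_ge0// => m _; rewrite divr_ge0// ltW.
exists c^-1; first by rewrite invr_gt0.
split=> m x Dx.
- apply: cvgB; first exact: (abm_cont H).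
  apply: cvgM; first exact: cvg_cst.
  by apply: cvg_within_filter; exact: continuous_horner.
- have d1 := abm_derive H m Dx.
  have d2 := is_derive_poly p^`(m) x.
  rewrite [X in is_derive _ _ X _](_ : _ = hd m - c^-1 *: horner p^`(m))//.
  by apply: is_derive_eq; rewrite derivnS.
- rewrite subr_gt0; have hx := abm_gt0 H m Dx.
  have [pm|mp] := leqP (size p) m.
    by rewrite derivn_poly0// horner0 mulr0.
  apply: lt_le_trans (_ : hd m (-1) <= _); last first.
    by move: Dx => /andP[? ?]; exact: (abs_monotone_le m H).
  apply: le_lt_trans (_ : c^-1 * B m < _).
    rewrite ler_wpM2l ?invr_ge0 ?(ltW c0)//.
    exact: le_trans (ler_norm _) (horner_bound _ Dx).
  rewrite mulrC ltr_pdivrMr// mulrC -ltr_pdivrMr//.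
  rewrite /c (bigD1 (Ordinal mp))//= addrCA ltrDl ltr_wpDr//.
  by rewrite sumr_ge0// => i _; rewrite divr_ge0// ltW.
Qed.
End Hermite.

(** * Positive definite polynomials and the linear programming bound *)

Section PositiveDefinite.
Variables (R : realType) (n q : nat).
Hypothesis q_gt0 : (0 < q)%N.
Hypothesis n_gt0 : (0 < n)%N.
Local Notation H := (hamming n q).
Implicit Types (f g : {poly R}) (u v : H).

Let n_neq0 : n%:R != 0 :> R.
Proof. by rewrite pnatr_eq0 -lt0n. Qed.

Definition pos_def f := gram (fun u v : H => f.[hinner R u v]).

Lemma pos_defC c : 0 <= c -> pos_def c%:P.
Proof. by move=> c0; apply: eq_gram (gram_cst _ c0) => u v; rewrite hornerC. Qed.

Lemma pos_defD f g : pos_def f -> pos_def g -> pos_def (f + g).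
Proof. by move=> pf pg; apply: eq_gram (gramD pf pg) => u v; rewrite hornerD. Qed.

Lemma pos_defM f g : pos_def f -> pos_def g -> pos_def (f * g).
Proof. by move=> pf pg; apply: eq_gram (gramM pf pg) => u v; rewrite hornerM. Qed.

Lemma pos_defZ c f : 0 <= c -> pos_def f -> pos_def (c *: f).
Proof. by move=> c0 pf; apply: eq_gram (gramZ c0 pf) => u v; rewrite hornerZ. Qed.

Lemma pos_def_sum (I : Type) (r : seq I) (P : pred I) (F : I -> {poly R}) :
  (forall i, P i -> pos_def (F i)) -> pos_def (\sum_(i <- r | P i) F i).
Proof.
move=> pF.
apply: (@eq_gram _ _ (fun u v : H => \sum_(i <- r | P i) (F i).[hinner R u v])).
  by move=> u v; rewrite horner_sum.
exact: gram_sum.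
Qed.

Lemma pos_def_kernel_poly j : pos_def (kernel_poly (kraw_poly q n n%:R) j).
Proof.
apply: pos_def_sum => i _; apply: eq_gram (@gram_krawtchouk R n q q_gt0 i) => u v.
by rewrite /hinner horner_kraw_poly.
Qed.

Lemma hdistC u v : hdist u v = hdist v u.
Proof. by apply: eq_card => s; rewrite !inE eq_sym. Qed.

Lemma hdistxx u : hdist u u = 0%N.
Proof. by apply: eq_card0 => s; rewrite !inE eqxx. Qed.

Lemma hdist_le u v : (hdist u v <= n)%N.
Proof. by rewrite -[X in (_ <= X)%N](card_ord n) max_card. Qed.

Lemma hdist_gt0 u v : u != v -> (0 < hdist u v)%N.
Proof.
apply: contraR; rewrite -eqn0Ngt cards_eq0 => /eqP/setP uv; apply/eqP/ffunP => s.
by have := uv s; rewrite !inE => /negbFE/eqP.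
Qed.

Lemma hinner_dom u v : u != v -> -1 <= hinner R u v < 1.
Proof.
move=> uv; rewrite /hinner; set d := hdist u v.
have d0 : 0 < d%:R :> R by rewrite ltr0n hdist_gt0.
have n0 : 0 < n%:R :> R by rewrite ltr0n.
have dn : d%:R <= n%:R :> R by rewrite ler_nat hdist_le.
have r1 : 2 * d%:R / n%:R <= 2 :> R by rewrite ler_pdivrMr//; lra.
have r2 : 0 < 2 * d%:R / n%:R :> R by rewrite divr_gt0// mulr_gt0.
lra.
Qed.

Lemma hinner_agree u v : 1 + hinner R u v = 2 / n%:R * \sum_(s < n) (u s == v s)%:R.
Proof.
have E : n%:R = (hdist u v)%:R + \sum_(s < n) (u s == v s)%:R :> R.
  rewrite /hdist -sum1_card natr_sum big_mkcond -big_split /=.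
  rewrite (eq_bigr (fun=> 1)) ?sumr_const ?card_ord// => s _.
  by rewrite inE; case: eqP; rewrite /= ?add0r ?addr0.
rewrite /hinner; set a := \sum_s _ in E *.
have -> : (hdist u v)%:R = n%:R - a by rewrite E addrK.
by field.
Qed.

(** By [hinner_agree], [1 + t] is a multiple of the sum of the agreement indicators; each is
    idempotent, so one copy can be given to [f] and one to [g]. *)
Lemma pos_def_1addXM f g :
  (forall s, gram (fun u v : H => (u s == v s)%:R * f.[hinner R u v])) ->
  (forall s, gram (fun u v : H => (u s == v s)%:R * g.[hinner R u v])) ->
  pos_def (('X + 1) * (f * g)).
Proof.
move=> gf gg; have c0 : 0 <= 2 / n%:R :> R by rewrite divr_ge0.
apply: eq_gram (gramZ c0 (gram_sum (index_enum 'I_n) (P := xpredT)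
  (fun s _ => gramM (gf s) (gg s)))) => u v.
rewrite !(hornerM, hornerD, hornerX, hornerC) [_ + 1]addrC hinner_agree -[RHS]mulrA.
congr (_ * _); rewrite mulr_suml; apply: eq_bigr => s _.
by case: eqP => _; rewrite ?(mul1r, mul0r).
Qed.

Lemma gram_agree_kernel_poly s j :
  gram (fun u v : H =>
    (u s == v s)%:R * (kernel_poly (kraw_poly q n.-1 n%:R) j).[hinner R u v]).
Proof.
apply: eq_gram (gram_sum (index_enum 'I_j.+1) (P := xpredT)
  (fun i _ => @gram_agree_krawtchouk R n q q_gt0 s i)) => u v.
by rewrite horner_sum mulr_sumr; apply: eq_bigr => i _; rewrite /hinner horner_kraw_poly.
Qed.

(** The quadratic form of [f] is evaluated at the indicator of [C] minus its mean [a]; all row and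
    column sums of the kernel are equal to [q ^ n] times the mean of [f]. *)
Lemma sum_pos_def (C : {set H}) f : pos_def f ->
  mean_coef n q f * #|C|%:R ^+ 2 <= \sum_(u in C) \sum_(v in C) f.[hinner R u v].
Proof.
move=> pf; set m := mean_coef n q f.
have qn0 : q%:R ^+ n != 0 :> R by rewrite expf_neq0// pnatr_eq0 -lt0n.
have row u : \sum_v f.[hinner R u v] = q%:R ^+ n * m.
  by have -> : m = mean_at q n n%:R f by []; rewrite (mean_at_hamming _ _ u) mulVKf.
have col v : \sum_u f.[hinner R u v] = q%:R ^+ n * m.
  by rewrite -(row v); apply: eq_bigr => u _; rewrite /hinner hdistC.
clearbody m; pose a : R := #|C|%:R / q%:R ^+ n.
have := gram_sum_ge0 (fun u : H => u) (fun u => (u \in C)%:R - a) pf.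
have -> : \sum_(u : H) \sum_(v : H) ((u \in C)%:R - a) * ((v \in C)%:R - a) * f.[hinner R u v] =
    \sum_(u in C) \sum_(v in C) f.[hinner R u v] - m * #|C|%:R ^+ 2.
  transitivity (\sum_(u : H) ((u \in C)%:R * (\sum_(v : H) (v \in C)%:R * f.[hinner R u v])
       - a * ((u \in C)%:R * (\sum_(v : H) f.[hinner R u v])))
     - a * \sum_(v : H) ((v \in C)%:R * \sum_(u : H) f.[hinner R u v])
     + a ^+ 2 * \sum_(u : H) \sum_(v : H) f.[hinner R u v]).
    have -> : \sum_(v : H) ((v \in C)%:R * \sum_(u : H) f.[hinner R u v]) =
        \sum_(u : H) \sum_(v : H) (v \in C)%:R * f.[hinner R u v].
      by rewrite exchange_big /=; apply: eq_bigr => v _; rewrite mulr_sumr.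
    rewrite !mulr_sumr -sumrB -big_split /=; apply: eq_bigr => u _.
    rewrite !mulr_sumr -!sumrB -big_split /=; apply: eq_bigr => v _.
    ring.
  under eq_bigr => u _ do rewrite row.
  under [X in _ - a * X + _]eq_bigr => v _ do rewrite col.
  under [X in _ + _ * X]eq_bigr => u _ do rewrite row.
  have cC : \sum_(u : H) (u \in C)%:R = #|C|%:R :> R.
    by rewrite -sum1_card natr_sum [RHS]big_mkcond; apply: eq_bigr => u _; case: (u \in C).
  have cH c : \sum_(u : H) c = q%:R ^+ n * c :> R.
    by rewrite sumr_const card_ffun !card_ord -[LHS]mulr_natl natrX.
  rewrite sumrB -!mulr_sumr -!mulr_suml cC cH.
  have -> : \sum_(u : H) (u \in C)%:R * (\sum_(v : H) (v \in C)%:R * f.[hinner R u v]) =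
      \sum_(u in C) \sum_(v in C) f.[hinner R u v].
    rewrite [RHS]big_mkcond; apply: eq_bigr => u _; case: (u \in C); rewrite ?mul0r//.
    rewrite mul1r [RHS]big_mkcond; apply: eq_bigr => v _.
    by case: (v \in C); rewrite ?mul0r ?mul1r.
  by rewrite /a; field.
by rewrite subr_ge0.
Qed.

Lemma mean_pos_def_ge0 f : pos_def f -> 0 <= mean_coef n q f.
Proof.
move=> /(gram_sum_ge0 (fun u : H => u) (fun=> 1)).
have row u : \sum_v f.[hinner R u v] = q%:R ^+ n * mean_coef n q f.
  rewrite -[mean_coef n q f]/(mean_at q n n%:R f) (mean_at_hamming _ _ u) mulVKf//.
  by rewrite expf_neq0// pnatr_eq0 -lt0n.
under eq_bigr do under eq_bigr do rewrite !mul1r.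
under eq_bigr do rewrite row.
rewrite sumr_const pmulrn_lge0 ?card_ffun ?card_ord ?expn_gt0 ?q_gt0//.
by rewrite pmulr_rge0// exprn_gt0// ltr0n.
Qed.

(** The Delsarte bound: in [sum_pos_def] the diagonal contributes [f(1)] per codeword, and off the
    diagonal [f] is at most [h]. *)
Lemma energy_ge (C : {set H}) f (h : R -> R) : (0 < #|C|)%N -> pos_def f ->
  (forall t, -1 <= t < 1 -> f.[t] <= h t) ->
  mean_coef n q f * #|C|%:R - f.[1] <= energy h C.
Proof.
move=> C0 pf fh; have c0 : 0 < #|C|%:R :> R by rewrite ltr0n.
rewrite /energy [_^-1 * _]mulrC ler_pdivlMr// mulrBl -mulrA -expr2.
rewrite lerBlDr (le_trans (sum_pos_def C pf))//.
have -> : f.[1] * #|C|%:R = \sum_(u in C) f.[1] by rewrite sumr_const mulr_natr.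
rewrite -big_split /=; apply: ler_sum => u uC.
rewrite (bigD1 u)//= addrC lerD//; last by rewrite /hinner hdistxx mulr0 mul0r subr0.
rewrite (eq_bigl (fun v => (v \in C) && (u != v))) => [|v]; last by rewrite eq_sym.
by apply: ler_sum => v /andP[_ uv]; apply/fh/hinner_dom.
Qed.
End PositiveDefinite.

(** * The universal bound and its test functions *)

Section UniversalBound.
Variables (R : realType) (n q tau M : nat).
Hypothesis n_gt0 : (0 < n)%N.
Hypothesis q_gt1 : (1 < q)%N.
Hypothesis tau_gt0 : (0 < tau)%N.
Hypothesis M_bounds : (rao n q tau < M <= rao n q tau.+1)%N.
Variables (x w : 'I_(tau./2).+1 -> R).
Hypothesis quad : levenshtein_quadrature n q M x w.
Implicit Types (f g : {poly R}).

Let q_gt0 : (0 < q)%N := ltnW q_gt1.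

Let M_gt0 : 0 < M%:R :> R.
Proof. by rewrite ltr0n; case/andP: M_bounds => + _; exact: leq_ltn_trans. Qed.

Lemma quadrature_node_dom i : -1 <= x i < 1.
Proof.
have x0 : -1 <= x ord0.
  have [ot|et] := boolP (odd tau); first exact/ltW/(lq_first_odd quad).
  by rewrite (lq_first_even quad et).
apply/andP; split.
  have [->//|i0] := eqVneq i ord0.
  rewrite (le_trans x0)// ltW// (lq_increasing quad)// lt0n.
  by apply: contra i0 => /eqP i0; apply/eqP/val_inj.
have [->|im] := eqVneq i ord_max; first exact: lq_last quad.
rewrite (lt_trans _ (lq_last quad))// (lq_increasing quad)//= ltn_neqAle -ltnS ltn_ord andbT.
by apply: contra im => /eqP im; apply/eqP/val_inj.
Qed.

(** Nodes indexed by naturals, as the quadrature section expects; [inord] sends an index out of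
    range to 0, so every [xn i] is still a node. *)
Let xn (i : nat) := x (inord i).
Let wn (i : nat) := w (inord i).

Let xn_incr i j : (i < j)%N -> (j <= tau./2)%N -> xn i < xn j.
Proof.
move=> ij jt; apply: (lq_increasing quad); rewrite !inordK ?ltnS//.
exact: leq_trans (ltnW ij) jt.
Qed.

Lemma pos_def_newton_form_odd a b : odd tau ->
  (forall m, (m < (tau./2).+1)%N -> 0 <= a m /\ 0 <= b m) ->
  pos_def n q (newton_form xn a b (tau./2).+1).
Proof.
move=> ot ab; have [kn /andP[M1 M2]] := rao_odd_bounds q_gt0 n_gt0 ot M_bounds.
have pg m : (m <= (tau./2).+1)%N -> pos_def n q (node_poly xn m).
  move=> mk.
  have [||||||||c [c0 ->]] := @quadrature_node_poly R q q_gt0 n n%:R (tau./2).+1 xn wn M%:R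
    _ _ _ _ _ _ _ _ m mk => //.
  - by rewrite ltr0n.
  - by move=> i _; rewrite /xn; have /andP[] := quadrature_node_dom (inord i).
  - by move=> i _; exact: lq_weight_gt0 quad _.
  - by rewrite ltr_nat ler_nat M1.
  - move=> f sf; rewrite -[LHS]/(mean_coef n q f) (lq_exact quad).
      by congr (_ + _); apply: eq_bigr => i _; rewrite /xn /wn inord_val.
    by rewrite (leq_trans sf)// -[in leqRHS](odd_double_half tau) ot -mul2n; lia.
  apply: pos_def_sum => j _; apply: pos_defZ; first by rewrite c0// -ltnS.
  exact: pos_def_kernel_poly.
apply: pos_def_sum => m _; have [a0 b0] := ab m (ltn_ord m).
apply: pos_defD; apply: pos_defZ => //; apply: pos_defM; apply: pg;
  by rewrite // ltnW.
Qed.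

Lemma pos_def_newton_form_even a b : ~~ odd tau ->
  (forall m, (m < tau./2)%N -> 0 <= a m /\ 0 <= b m) ->
  pos_def n q (('X + 1) * newton_form (fun i => xn i.+1) a b tau./2).
Proof.
move=> et ab; pose y i := xn i.+1.
have [kn /andP[M1 M2]] := rao_even_bounds q_gt0 n_gt0 tau_gt0 et M_bounds.
have k0 : (0 < tau./2)%N by rewrite half_gt0; case: tau tau_gt0 et => [|[]].
have q0 : 0 < q%:R :> R by rewrite ltr0n.
have x0 : xn 0 = -1.
  by rewrite -(lq_first_even quad et) /xn; congr x; apply/val_inj; rewrite /= inordK.
(* Weights of the rule for length [n - 1]: [mean_at_delete] brings the factor [1 + t], which kills
   the node [-1], and the constant [q / 2]. At 1 this factor is 2, whence [M / q]. *)
pose v i := q%:R / 2 * (wn i.+1 * (1 + y i)).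
have pg m s : (m <= tau./2)%N ->
    gram (fun u u' : hamming n q => (u s == u' s)%:R * (node_poly y m).[hinner R u u']).
  move=> mk.
  have [||||||||c [c0 ->]] := @quadrature_node_poly R q q_gt0 n.-1 n%:R tau./2 y v (M%:R / q%:R)
    _ _ _ _ _ _ _ _ m mk => //.
  - by rewrite ltr0n.
  - by rewrite k0.
  - by move=> i j ij jk; exact: xn_incr.
  - by move=> i _; rewrite /y /xn; have /andP[] := quadrature_node_dom (inord i.+1).
  - move=> i ik; rewrite mulr_gt0 ?divr_gt0// mulr_gt0 ?(lq_weight_gt0 quad)//.
    by rewrite addrC -ltrBlDr sub0r -x0 xn_incr.
  - by rewrite divr_gt0.
  - by rewrite ltr_pdivlMr// ler_pdivrMr// -!natrM mulnC ltr_nat M1 mulnC ler_nat.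
  - move=> f sf; have nE : n = n.-1.+1 by rewrite prednK.
    rewrite {1 2}nE -pred_Sn mean_at_delete// -nE -[mean_at _ _ _ _]/(mean_coef n q _).
    rewrite (lq_exact quad); last first.
      have s2 : size (1 + 'X : {poly R})%R = 2 by rewrite addrC -polyC1 size_XaddC.
      rewrite (leq_trans (size_polyMleq _ _))// s2 add2n /= ltnS (leq_trans sf)//.
      by rewrite -[in leqRHS](odd_double_half tau) (negPf et) -mul2n.
    rewrite hornerM hornerD hornerX hornerC mulrDr; congr (_ + _).
      by field; rewrite !gt_eqF.
    rewrite big_ord_recl hornerM hornerD hornerX hornerC (lq_first_even quad et).
    rewrite subrr mul0r mulr0 add0r mulr_sumr; apply: eq_bigr => i _.
    have -> : lift ord0 i = inord i.+1 by apply/val_inj; rewrite /= inordK// ltnS.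
    rewrite hornerM hornerD hornerX hornerC /v /y /xn /wn.
    by rewrite !mulrA.
  apply: (@eq_gram _ _ (fun u u' : hamming n q => \sum_(j < m.+1) c j *
      ((u s == u' s)%:R * (kernel_poly (kraw_poly q n.-1 n%:R) j).[hinner R u u']))).
    move=> u u'; rewrite horner_sum mulr_sumr; apply: eq_bigr => j _.
    by rewrite hornerZ mulrCA.
  apply: gram_sum => j _; apply: gramZ; first by rewrite c0// -ltnS.
  exact: gram_agree_kernel_poly.
rewrite mulr_sumr; apply: pos_def_sum => m _; have [a0 b0] := ab m (ltn_ord m).
rewrite mulrDr -!scalerAr.
apply: pos_defD; apply: pos_defZ => //; apply: pos_def_1addXM => // s; apply: pg;
  by rewrite // ltnW.
Qed.

Lemma universal_hermite (hd : nat -> R -> R) : abs_monotone hd ->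
  exists f, [/\ (size f <= tau.+1)%N, forall i, f.[x i] = hd 0%N (x i),
    forall t, -1 <= t < 1 -> f.[t] <= hd 0%N t & pos_def n q f].
Proof.
move=> H.
have Dx i : (i <= tau./2)%N -> -1 <= xn i < 1.
  by move=> _; exact: quadrature_node_dom.
have tauE := odd_double_half tau; rewrite -mul2n in tauE.
have [ot|et] := boolP (odd tau).
  have [|a [b [r [ab r0 hE]]]] := @hermite_double R hd (tau./2).+1 xn H; first exact: Dx.
  exists (newton_form xn a b (tau./2).+1); split.
  - by rewrite (leq_trans (size_newton_form _ _ _ _))// -[in leqRHS]tauE ot; lia.
  - move=> i; have := hE _ (quadrature_node_dom i).
    have -> : x i = xn i by rewrite /xn inord_val.
    by rewrite node_poly_root// expr0n mul0r addr0 => ->.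
  - by move=> t Dt; rewrite (hE t Dt) lerDl mulr_ge0 ?sqr_ge0 ?r0.
  - exact: pos_def_newton_form_odd.
have D1 : -1 <= (-1 : R) < 1 by lra.
have x0 : xn 0 = -1.
  by rewrite -(lq_first_even quad et) /xn; congr x; apply/val_inj; rewrite /= inordK.
(* For even [tau] a single divided difference splits off the simple node [-1]; the other [tau./2]
   nodes are double, giving degree at most [tau]. The extra factor [t + 1] of the remainder is
   nonnegative. *)
have H1 := abs_monotone_ddiff H D1.
have [|a [b [r [ab r0 hE]]]] := @hermite_double R _ tau./2 (fun i => xn i.+1) H1.
  by move=> i; exact: Dx.
set f1 := newton_form _ a b _ in hE.
have fE t : -1 <= t < 1 -> hd 0%N t = ((hd 0%N (-1))%:P + ('X + 1) * f1).[t] +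
    (t + 1) * ((node_poly (fun i => xn i.+1) tau./2).[t] ^+ 2 * r t).
  move=> Dt; rewrite (ddiffE hd (-1) t) hE//.
  by rewrite !(hornerM, hornerD, hornerX, hornerC); ring.
exists ((hd 0%N (-1))%:P + ('X + 1) * f1); split.
- have s2 : size ('X + 1 : {poly R})%R = 2 by rewrite -polyC1 size_XaddC.
  apply: (leq_trans (size_polyD _ _)); rewrite geq_max (leq_trans (size_polyC_leq1 _))//.
  rewrite (leq_trans (size_polyMleq _ _))// s2 add2n /= ltnS.
  by rewrite (leq_trans (size_newton_form _ _ _ _))// -[in leqRHS]tauE (negPf et).
- move=> i; have := fE _ (quadrature_node_dom i).
  have -> : x i = xn i by rewrite /xn inord_val.
  have [->|i0] := eqVneq i ord0.
    by rewrite [xn _]x0 addNr mul0r addr0.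
  have ik : (i.-1 < tau./2)%N by have := ltn_ord i; have := i0; rewrite -val_eqE /=; lia.
  have -> : xn i = (fun j => xn j.+1) i.-1.
    by rewrite prednK// lt0n -[0%N]/(val (ord0 : 'I_(tau./2).+1)).
  by rewrite node_poly_root// expr0n mul0r mulr0 addr0 => ->.
- move=> t Dt; rewrite (fE t Dt) lerDl mulr_ge0//; first by move: Dt => /andP[? ?]; lra.
  by rewrite mulr_ge0 ?sqr_ge0 ?r0.
- apply: pos_defD; first by apply: pos_defC; exact/ltW/(abm_gt0 H).
  exact: pos_def_newton_form_even.
Qed.

Lemma Qpoly_kraw_poly j : Qpoly R n q j =
  (q.-1%:R ^+ j * 'C(n, j)%:R)^-1 *: kraw_poly q n n%:R j.
Proof. by []. Qed.

Let rank_gt0 j : (j <= n)%N -> 0 < q.-1%:R ^+ j * 'C(n, j)%:R :> R.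
Proof.
move=> jn; rewrite mulr_gt0 ?ltr0n ?bin_gt0//.
by rewrite exprn_gt0// ltr0n -subn1 subn_gt0.
Qed.

Lemma size_Qpoly j : (j <= n)%N -> size (Qpoly R n q j) = j.+1.
Proof.
move=> jn; rewrite Qpoly_kraw_poly size_scale ?invr_eq0 ?gt_eqF ?rank_gt0//.
by have [] := @kraw_poly_lead R q q_gt0 n n%:R j _; rewrite ?ltr0n.
Qed.

Lemma horner_Qpoly1 j : (j <= n)%N -> (Qpoly R n q j).[1] = 1.
Proof.
move=> jn; rewrite Qpoly_kraw_poly hornerZ horner_kraw_poly1//.
by rewrite mulVf// gt_eqF// rank_gt0.
Qed.

Lemma mean_coef_Qpoly j : (0 < j)%N -> (j <= n)%N -> mean_coef n q (Qpoly R n q j) = 0.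
Proof.
move=> j0 jn; rewrite -[LHS]/(mean_at q n n%:R _) Qpoly_kraw_poly linearZ /=.
rewrite -[kraw_poly _ _ _ _]mulr1 -(kraw_poly0 q n n%:R).
by rewrite mean_at_kraw_polyM ?pnatr_eq0 -?lt0n// gtn_eqF ?mulr0.
Qed.

(** By orthogonality each coefficient is the mean of [f] times a Krawtchouk polynomial, a product of
    positive definite polynomials. *)
Lemma pos_def_Qpoly_expansion f : (size f <= n.+1)%N -> pos_def n q f ->
  exists2 c : nat -> R, f = \sum_(i < n.+1) c i *: Qpoly R n q i &
    forall i, (i <= n)%N -> 0 <= c i.
Proof.
move=> sf pf; have n0 : 0 < n%:R :> R by rewrite ltr0n.
have nn0 : n%:R != 0 :> R by rewrite gt_eqF.
have [i _|d fE] := @graded_span _ (kraw_poly q n n%:R) n.+1 _ f sf.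
  by have [] := kraw_poly_lead q_gt0 n i n0.
exists (fun i => d i * (q.-1%:R ^+ i * 'C(n, i)%:R)) => [|i ni].
  rewrite {1}fE; apply: eq_bigr => i _.
  by rewrite Qpoly_kraw_poly scalerA mulfK// gt_eqF ?rank_gt0// -ltnS.
have -> : d i * (q.-1%:R ^+ i * 'C(n, i)%:R) =
    mean_coef n q (f * kraw_poly q n n%:R i).
  rewrite -[RHS]/(mean_at q n n%:R _) {1}fE mulr_suml linear_sum /=.
  have ni' : (i < n.+1)%N by [].
  rewrite (bigD1 (Ordinal ni'))//= big1 ?addr0 => [|l /negPf li].
    by rewrite -scalerAl linearZ /= mean_at_kraw_polyM// eqxx horner_kraw_poly1.
  rewrite -scalerAl linearZ /= mean_at_kraw_polyM//.
  by rewrite -[i]/(val (Ordinal ni')) val_eqE li mulr0.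
apply: mean_pos_def_ge0 => //; apply: pos_defM => //.
by apply: eq_gram (@gram_krawtchouk R n q q_gt0 i) => u v; rewrite /hinner horner_kraw_poly.
Qed.

(** [M] times the quadrature error. It vanishes up to degree [tau], and for [f] agreeing with [h] at
    the nodes it is the exact gain over the bound. *)
Definition excess f := mean_coef n q f * M%:R - f.[1] - M%:R * \sum_i w i * f.[x i].

Fact excess_is_linear : scalar excess.
Proof.
move=> a f g; rewrite /excess hornerD hornerZ.
have -> : mean_coef n q (a *: f + g) = a * mean_coef n q f + mean_coef n q g.
  by rewrite -[LHS]/(mean_at q n n%:R _) linearP.
have -> : \sum_i w i * (a *: f + g).[x i] =
    a * \sum_i w i * f.[x i] + \sum_i w i * g.[x i].
  by rewrite mulr_sumr -big_split; apply: eq_bigr => i _; rewrite /= hornerD hornerZ; ring.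
ring.
Qed.

HB.instance Definition _ := GRing.isLinear.Build R {poly R} R _ excess excess_is_linear.

Lemma excess_low f : (size f <= tau.+1)%N -> excess f = 0.
Proof.
move=> sf; rewrite /excess (lq_exact quad sf) mulrDl divfK ?gt_eqF//.
by rewrite [f.[1] + _]addrC addrK mulrC subrr.
Qed.

Lemma excess_Qpoly j : (0 < j)%N -> (j <= n)%N ->
  excess (Qpoly R n q j) = - (M%:R * test_function n q M x w j).
Proof.
move=> j0 jn; rewrite /excess mean_coef_Qpoly// horner_Qpoly1// /test_function.
by rewrite mulrDr divff ?gt_eqF//; ring.
Qed.

Lemma T_dom t : T_ R n t -> t != 1 -> -1 <= t < 1.
Proof.
move=> [i ni ->] t1; have n0 : 0 < n%:R :> R by rewrite ltr0n.
have r0 : 0 <= 2 * i%:R / n%:R :> R by rewrite divr_ge0// mulr_ge0.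
have r2 : 2 * i%:R / n%:R <= 2 :> R.
  by rewrite ler_pdivrMr// ler_pM2l// ler_nat.
rewrite lt_neqAle t1; lra.
Qed.

(** The Hermite interpolant of [h] has zero excess, so its linear programming bound is the universal
    bound. *)
Lemma universal_bound_energy (h : R -> R) (C : {set hamming n q}) :
  strictly_absolutely_monotone h -> #|C| = M -> universal_bound M x w h <= energy h C.
Proof.
move=> /strictly_absolutely_monotoneP[hd H hE] CM.
have [f [sf fx fh pf]] := universal_hermite H.
have C0 : (0 < #|C|)%N by rewrite CM -(ltr0n R).
have fh' t : -1 <= t < 1 -> f.[t] <= h t by move=> Dt; rewrite -hE// fh.
apply: le_trans (energy_ge q_gt0 n_gt0 C0 pf fh'); rewrite CM.
have /eqP := excess_low sf; rewrite subr_eq0 => /eqP ->.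
rewrite /universal_bound le_eqVlt; apply/orP; left; apply/eqP; congr (_ * _).
by apply: eq_bigr => i _; rewrite fx hE//; exact: quadrature_node_dom.
Qed.

Lemma improving_polynomial (h : R -> R) j : strictly_absolutely_monotone h ->
  (tau.+1 <= j <= n)%N -> test_function n q M x w j < 0 ->
  exists2 f : {poly R}, A_code n q h f &
    [/\ size f = j.+1, forall t, -1 <= t < 1 -> f.[t] <= h t &
        universal_bound M x w h < mean_coef n q f * M%:R - f.[1]].
Proof.
move=> /strictly_absolutely_monotoneP[hd H hE] /andP[tj jn] Pj.
have j0 : (0 < j)%N by exact: leq_trans tj.
have [e e0 He] := abs_monotone_sub (Qpoly R n q j) H.
have [g [sg gx gh pg]] := universal_hermite He.
have sQ := size_Qpoly jn.
(* From [g <= h - e Q_j] follows [f <= h], with equality at the nodes; since [g] has degree at most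
   [tau < j], the degree of [f] is [j]. *)
pose f := e *: Qpoly R n q j + g.
have fh t : -1 <= t < 1 -> f.[t] <= h t.
  move=> Dt; rewrite hornerD hornerZ addrC -lerBrDr -hE//; exact: gh.
exists f; last split=> //.
- have [||c gE c0] := @pos_def_Qpoly_expansion g.
  + by rewrite (leq_trans sg)// ltnS (leq_trans _ jn)// ltnW.
  + exact: pg.
  have jn' : (j < n.+1)%N by [].
  exists (fun i => (if i == j then e else 0) + c i); split.
  + rewrite /f gE; under [RHS]eq_bigr do rewrite scalerDl.
    rewrite big_split /=; congr (_ + _).
    rewrite (bigD1 (Ordinal jn'))//= eqxx big1 ?addr0// => i /negPf ij.
    by rewrite -[j]/(val (Ordinal jn')) val_eqE ij scale0r.
  + by move=> t Tt t1; apply/fh/T_dom.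
  + move=> i /andP[_ ni]; rewrite addr_ge0 ?c0//; case: ifP => // _; exact: ltW.
- rewrite size_polyDl size_scale ?gt_eqF// sQ.
  by rewrite ltnS (leq_trans sg).
have : excess f = - (e * (M%:R * test_function n q M x w j)).
  by rewrite linearP /= (excess_low sg) addr0 excess_Qpoly// mulrN.
have -> : excess f = mean_coef n q f * M%:R - f.[1] - universal_bound M x w h.
  rewrite /excess /universal_bound; congr (_ - _ * _); apply: eq_bigr => i _.
  by rewrite hornerD hornerZ gx /= hE ?subrKC//; exact: quadrature_node_dom.
move=> E; rewrite -subr_gt0 E oppr_gt0.
by rewrite pmulr_rlt0// pmulr_rlt0.
Qed.

Lemma improvable_test_function (h : R -> R) f (c : nat -> R) :
  f = \sum_(i < n.+1) c i *: Qpoly R n q i ->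
  (forall i, (tau.+1 <= i <= n)%N -> 0 <= c i) ->
  (forall t, -1 <= t < 1 -> f.[t] <= h t) ->
  universal_bound M x w h < mean_coef n q f * M%:R - f.[1] ->
  exists j : nat, (tau.+1 <= j <= n)%N /\ test_function n q M x w j < 0.
Proof.
move=> fE c0 fh imp; apply: contrapT => nP.
have P0 j : (tau.+1 <= j <= n)%N -> 0 <= test_function n q M x w j.
  by move=> tjn; rewrite leNgt; apply/negP => Pj; apply: nP; exists j.
(* As [f <= h] at the nodes and the weights are positive, the gain over the bound is at most
   [excess f]. *)
have : 0 < excess f.
  rewrite subr_gt0; apply: le_lt_trans imp; rewrite ler_pM2l//.
  apply: ler_sum => i _; rewrite ler_wpM2l ?(ltW (lq_weight_gt0 quad _))//.
  exact/fh/quadrature_node_dom.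
rewrite ltNge => /negP; apply; rewrite fE linear_sum /=; apply: sumr_le0 => i _.
rewrite linearZ /=; have ni : (i <= n)%N by rewrite -ltnS.
have [it|ti] := leqP i tau; first by rewrite excess_low ?mulr0// size_Qpoly.
rewrite excess_Qpoly//; last exact: leq_trans ti.
rewrite mulrN oppr_le0 !mulr_ge0 ?c0 ?P0 ?ti//; exact: ltW.
Qed.
End UniversalBound.

Theorem theorem5p1 (R : realType) (n q tau M : nat)
  (hn : (1 <= n)%N) (hq : (2 <= q)%N) (htau : (1 <= tau)%N)
  (hM : (rao n q tau < M <= rao n q tau.+1)%N)
  (h : R -> R) (hh : strictly_absolutely_monotone h)
  (x w : 'I_(tau./2).+1 -> R) (hxw : levenshtein_quadrature n q M x w) :
  let B := universal_bound M x w h in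
  let P := test_function n q M x w in
  [/\ (B%:E <= min_design_energy n q M tau h)%E,
      (B%:E <= min_energy n q M h)%E &
      forall A : set {poly R}, A = A_design n q tau h \/ A = A_code n q h ->
        ((exists f : {poly R},
            [/\ A f,
                (tau.+1 < size f)%N,
                forall t, -1 <= t < 1 -> f.[t] <= h t &
                B < mean_coef n q f * M%:R - f.[1]])
         <-> (exists j : nat, (tau.+1 <= j <= n)%N /\ P j < 0))
        /\
        (forall j : nat, (tau.+1 <= j <= n)%N -> P j < 0 ->
           exists f : {poly R},
             [/\ A f,
                 size f = j.+1,
                 forall t, -1 <= t < 1 -> f.[t] <= h t &
                 B < mean_coef n q f * M%:R - f.[1]])].
Proof.
  move=> B P.
have Elb : (B%:E <= min_energy n q M h)%E.
  apply: le_ereal_inf_tmp => _ [C CM ->]; rewrite lee_fin.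
  exact: (universal_bound_energy hn hq htau hM hxw hh CM).
split=> //.
  apply: le_ereal_inf_tmp => _ [C [_ CM] ->]; rewrite lee_fin.
  exact: (universal_bound_energy hn hq htau hM hxw hh CM).
move=> A AE.
(* [A_code] is contained in [A_design], so one construction serves both choices of [A]. *)
have codeA f : A_code n q h f -> A f.
  case: AE => -> // -[c [fE fh c0]]; exists c; split=> // i /andP[ti ni].
  by apply: c0; rewrite ni andbT (leq_trans _ ti).
have improve j : (tau.+1 <= j <= n)%N -> P j < 0 -> exists f : {poly R},
    [/\ A f, size f = j.+1, forall t, -1 <= t < 1 -> f.[t] <= h t &
        B < mean_coef n q f * M%:R - f.[1]].
  move=> jn Pj; have [f Af [sf fh imp]] := improving_polynomial hn hq htau hM hxw hh jn Pj.
  by exists f; split=> //; exact: codeA.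
split=> //; split=> [[f [Af sf fh imp]]|[j [jn Pj]]].
  (* Both classes provide nonnegative coefficients from degree [tau + 1] on, the only ones that
     contribute to the excess. *)
  have [c [fE c0]] : exists c : nat -> R, f = \sum_(i < n.+1) c i *: Qpoly R n q i /\
      forall i, (tau.+1 <= i <= n)%N -> 0 <= c i.
    case: AE Af => -> [c [fE _ c0]]; exists c; split=> //.
    by move=> i /andP[ti ni]; apply: c0; rewrite ni andbT (leq_trans _ ti).
  exact: (improvable_test_function hn hq hM hxw fE c0 fh imp).
have [f [Af sf fh imp]] := improve j jn Pj.
by exists f; split=> //; rewrite sf ltnS; case/andP: jn.
Qed.
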